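(* There exist semi-abelian categories that are neither integral nor quasi-abelian. In particular, for fixed $k\in\{\mathbb{R},\mathbb{C}\}$, the product category $\mathsf{BAN}\times\mathsf{BOR}$ is semi-abelian, is not integral, and is not quasi-abelian, where $\mathsf{BAN}$ is the category of Banach spaces over $k$ and $\mathsf{BOR}$ is the category of bornological (Hausdorff and non-Hausdorff) locally convex spaces over $k$, both with linear and continuous maps as morphisms.
   Context: A locally convex space (not assumed Hausdorff) is bornological if every absolutely convex subset that absorbs all bounded sets is a neighbourhood of $0$. The product category $\mathcal{A}\times\mathcal{B}$ has as objects the pairs $(A,B)$ with $A\in\mathcal{A}$, $B\in\mathcal{B}$, and as morphisms the pairs $(f,g)$ with $f$ a morphism in $\mathcal{A}$ and $g$ a morphism in $\mathcal{B}$. An additive category is pre-abelian if every morphism has a kernel and a cokernel. A morphism is called ''a kernel'' (resp. ''a cokernel'') if it is the kernel (resp. cokernel) of some morphism. A pre-abelian category is left semi-abelian if every morphism can be written as $i\circ p$ with $i$ a monomorphism and $p$ a cokernel, right semi-abelian if every morphism can be written as $i\circ p$ with $i$ a kernel and $p$ an epimorphism, and semi-abelian if it is both. A class $\mathcal{X}$ of morphisms is stable under pullback if in any pullback square with $a\colon A\to B$, $b\colon A\to C$, $c\colon B\to D$, $d\colon C\to D$ and $c\circ a=d\circ b$, one has $a\in\mathcal{X}$ whenever $d\in\mathcal{X}$; stability under pushout is defined dually. A pre-abelian category is quasi-abelian if cokernels are stable under pullback and kernels are stable under pushout. A pre-abelian category is integral if epimorphisms are stable under pullback and monomorphisms are stable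 under pushout. *)

(* Defs.v *)
From HB Require Import structures.
From mathcomp Require Import all_boot all_order all_algebra.
From mathcomp Require Import all_classical all_reals all_analysis.
From mathcomp Require Import complex.

Set Implicit Arguments.
Unset Strict Implicit.
Unset Printing Implicit Defensive.

Import Order.TTheory GRing.Theory Num.Theory.
Import numFieldNormedType.Exports.

Local Open Scope classical_set_scope.
Local Open Scope ring_scope.

Record category := Category {
  Ob :> Type;
  Mor : Ob -> Ob -> Type;
  idm : forall A, Mor A A;
  compm : forall A B C, Mor B C -> Mor A B -> Mor A C;
  compmA : forall A B C D (h : Mor C D) (g : Mor B C) (f : Mor A B),
    compm h (compm g f) = compm (compm h g) f;
  comp1m : forall A B (f : Mor A B), compm (idm B) f = f;
  compm1 : forall A B (f : Mor A B), compm f (idm A) = f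
}.

Notation "g \oc f" := (compm g f) (at level 50, left associativity).

Definition full_subcategory (C : category) (I : Type) (F : I -> C) : category :=
  {| Ob := I;
     Mor A B := Mor (F A) (F B);
     idm A := idm (F A);
     compm A B C' g f := g \oc f;
     compmA A B C' D h g f := compmA h g f;
     comp1m A B f := comp1m f;
     compm1 A B f := compm1 f |}.

Section ProductCategory.
Variables C D : category.

Let Hom2 (X Y : C * D) : Type := (Mor X.1 Y.1 * Mor X.2 Y.2)%type.
Let id2 X : Hom2 X X := (idm X.1, idm X.2).
Let comp2 X Y Z (g : Hom2 Y Z) (f : Hom2 X Y) : Hom2 X Z :=
  (g.1 \oc f.1, g.2 \oc f.2).

Let comp2A X Y Z W (h : Hom2 Z W) (g : Hom2 Y Z) (f : Hom2 X Y) :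
  comp2 h (comp2 g f) = comp2 (comp2 h g) f.
Proof. by rewrite /comp2 /= !compmA. Qed.

Let comp21 X Y (f : Hom2 X Y) : comp2 (id2 Y) f = f.
Proof. by case: f => f g; rewrite /comp2 /= !comp1m. Qed.

Let comp12 X Y (f : Hom2 X Y) : comp2 f (id2 X) = f.
Proof. by case: f => f g; rewrite /comp2 /= !compm1. Qed.

Definition prod_category : category := Category comp2A comp21 comp12.

End ProductCategory.

Definition morphism_class (C : category) :=
  forall A B : C, Mor A B -> Prop.

Section CategoryNotions.
Variable C : category.
Implicit Types A B D X Z : C.

Definition mono A B (f : Mor A B) : Prop :=
  forall X (g h : Mor X A), f \oc g = f \oc h -> g = h.

Definition epi A B (f : Mor A B) : Prop :=
  forall X (g h : Mor B X), g \oc f = h \oc f -> g = h.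

Definition zero_object Z : Prop :=
  forall A, (exists! f : Mor Z A, True) /\ (exists! f : Mor A Z, True).

Definition zero_morphism A B (f : Mor A B) : Prop :=
  exists Z, zero_object Z /\
    exists (p : Mor A Z) (i : Mor Z B), f = i \oc p.

Record preadditive_structure := PreadditiveStructure {
  addm : forall A B, Mor A B -> Mor A B -> Mor A B;
  zerom : forall A B, Mor A B;
  oppm : forall A B, Mor A B -> Mor A B;
  addmA : forall A B, associative (@addm A B);
  addmC : forall A B, commutative (@addm A B);
  add0m : forall A B, left_id (zerom A B) (@addm A B);
  addNm : forall A B, left_inverse (zerom A B) (@oppm A B) (@addm A B);
  compmDl : forall A B D (g h : Mor B D) (f : Mor A B),
    addm g h \oc f = addm (g \oc f) (h \oc f);
  compmDr : forall A B D (g : Mor B D) (f h : Mor A B),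
    g \oc addm f h = addm (g \oc f) (g \oc h)
}.

(* The remaining identities q \oc i = 0 and p \oc j = 0 follow from these. *)
Definition biproduct (P : preadditive_structure) A B S
    (i : Mor A S) (j : Mor B S) (p : Mor S A) (q : Mor S B) : Prop :=
  [/\ p \oc i = idm A, q \oc j = idm B &
      addm P (i \oc p) (j \oc q) = idm S].

(* The zero morphisms of any such P are exactly those of zero_morphism, so
   kernels and cokernels below need not mention P. *)
Definition additive_category : Prop :=
  exists P : preadditive_structure,
    (exists Z, zero_object Z) /\
    (forall A B, exists S (i : Mor A S) (j : Mor B S)
       (p : Mor S A) (q : Mor S B), biproduct P i j p q).

Definition kernel_of A B D (k : Mor D A) (f : Mor A B) : Prop :=
  zero_morphism (f \oc k) /\
  forall X (g : Mor X A), zero_morphism (f \oc g) ->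
    exists! u : Mor X D, k \oc u = g.

Definition cokernel_of A B D (q : Mor B D) (f : Mor A B) : Prop :=
  zero_morphism (q \oc f) /\
  forall X (g : Mor B X), zero_morphism (g \oc f) ->
    exists! u : Mor D X, u \oc q = g.

Definition is_kernel D A (k : Mor D A) : Prop :=
  exists B (f : Mor A B), kernel_of k f.

Definition is_cokernel B D (q : Mor B D) : Prop :=
  exists A (f : Mor A B), cokernel_of q f.

Definition pre_abelian : Prop :=
  additive_category /\
  forall A B (f : Mor A B),
    (exists D (k : Mor D A), kernel_of k f) /\
    (exists D (q : Mor B D), cokernel_of q f).

Definition left_semi_abelian : Prop :=
  pre_abelian /\
  forall A B (f : Mor A B), exists D (p : Mor A D) (i : Mor D B),
    [/\ f = i \oc p, mono i & is_cokernel p].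

Definition right_semi_abelian : Prop :=
  pre_abelian /\
  forall A B (f : Mor A B), exists D (p : Mor A D) (i : Mor D B),
    [/\ f = i \oc p, is_kernel i & epi p].

Definition semi_abelian : Prop := left_semi_abelian /\ right_semi_abelian.

(* The squares below have the following shape.
          a
      A -----> B
      |        |
    b |        | c
      v        v
      E -----> D
          d                                                                   *)
Definition pullback_square A B E D
    (a : Mor A B) (b : Mor A E) (c : Mor B D) (d : Mor E D) : Prop :=
  c \oc a = d \oc b /\
  forall X (u : Mor X B) (v : Mor X E), c \oc u = d \oc v ->
    exists! w : Mor X A, a \oc w = u /\ b \oc w = v.

Definition pushout_square A B E D
    (a : Mor A B) (b : Mor A E) (c : Mor B D) (d : Mor E D) : Prop :=
  c \oc a = d \oc b /\
  forall X (u : Mor B X) (v : Mor E X), u \oc a = v \oc b ->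
    exists! w : Mor D X, w \oc c = u /\ w \oc d = v.

Definition stable_under_pullback (M : morphism_class C) : Prop :=
  forall A B E D (a : Mor A B) (b : Mor A E) (c : Mor B D) (d : Mor E D),
    pullback_square a b c d -> M E D d -> M A B a.

Definition stable_under_pushout (M : morphism_class C) : Prop :=
  forall A B E D (a : Mor A B) (b : Mor A E) (c : Mor B D) (d : Mor E D),
    pushout_square a b c d -> M A B a -> M E D d.

Definition quasi_abelian : Prop :=
  [/\ pre_abelian, stable_under_pullback is_cokernel &
      stable_under_pushout is_kernel].

Definition integral_category : Prop :=
  [/\ pre_abelian, stable_under_pullback epi & stable_under_pushout mono].

End CategoryNotions.

Arguments additive_category C : clear implicits.
Arguments pre_abelian C : clear implicits.
Arguments left_semi_abelian C : clear implicits.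
Arguments right_semi_abelian C : clear implicits.
Arguments semi_abelian C : clear implicits.
Arguments quasi_abelian C : clear implicits.
Arguments integral_category C : clear implicits.

Section LocallyConvexSpaces.
Variable K : numFieldType.

Record linear_continuous_map (E F : tvsType K) := LinearContinuousMap {
  lcm_fun :> E -> F;
  lcm_linear : linear lcm_fun;
  lcm_continuous : continuous lcm_fun
}.

Arguments lcm_continuous {E F} l.

Lemma linear_continuous_map_eq (E F : tvsType K)
    (f g : linear_continuous_map E F) :
  lcm_fun f = lcm_fun g -> f = g.
Proof.
case: f g => f fl fc [g gl gc] /= fg; rewrite -{g}fg in gl gc *.
by rewrite (Prop_irrelevance fl gl) (Prop_irrelevance fc gc).
Qed.

Definition lcm_id (E : tvsType K) : linear_continuous_map E E :=
  @LinearContinuousMap E E (fun x => x) (fun _ _ _ => erefl)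
    (fun x => @cvg_id E (nbhs x)).

Lemma lcm_comp_linear (E F G : tvsType K) (g : linear_continuous_map F G)
    (f : linear_continuous_map E F) : linear (fun x => g (f x)).
Proof. by move=> a x y; rewrite lcm_linear lcm_linear. Qed.

Lemma lcm_comp_continuous (E F G : tvsType K) (g : linear_continuous_map F G)
    (f : linear_continuous_map E F) : continuous (fun x => g (f x)).
Proof.
by move=> x; exact: cvg_comp (lcm_continuous f x) (lcm_continuous g (f x)).
Qed.

Definition lcm_comp (E F G : tvsType K) (g : linear_continuous_map F G)
    (f : linear_continuous_map E F) : linear_continuous_map E G :=
  LinearContinuousMap (lcm_comp_linear g f) (@lcm_comp_continuous _ _ _ g f).

(* In the library, tvsType K is the type of locally convex (not necessarily
   Hausdorff) topological vector spaces over K. *)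
Definition LCS : category.
Proof.
refine (@Category (tvsType K) linear_continuous_map lcm_id lcm_comp _ _ _).
- by move=> *; exact: linear_continuous_map_eq.
- by move=> *; exact: linear_continuous_map_eq.
- by move=> *; exact: linear_continuous_map_eq.
Defined.

Definition absolutely_convex (E : tvsType K) (A : set E) : Prop :=
  forall (x y : E) (a b : K), A x -> A y -> `|a| + `|b| <= 1 ->
    A (a *: x + b *: y).

Definition absorbs (E : tvsType K) (A B : set E) : Prop :=
  exists2 r : K, 0 < r &
    forall t : K, r <= `|t| -> B `<=` [set t *: x | x in A].

(* von Neumann boundedness; the library's bounded_set is about norms *)
Definition vN_bounded (E : tvsType K) (B : set E) : Prop :=
  forall U : set E, nbhs (0 : E) U -> absorbs U B.

Definition bornological (E : tvsType K) : Prop :=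
  forall A : set E, absolutely_convex A ->
    (forall B : set E, vN_bounded B -> absorbs A B) -> nbhs (0 : E) A.

Definition BAN : category :=
  full_subcategory (C := LCS) (fun E : completeNormedModType K => E : tvsType K).

Definition BOR : category :=
  full_subcategory (C := LCS)
    (fun E : {E : tvsType K | bornological E} => sval E).

End LocallyConvexSpaces.

Arguments lcm_continuous {K E F} l.

(* Main.v *)
(** Semi-abelianness passes to products of categories, and a class of
    morphisms that is unstable under pullback in one factor is unstable in the
    product. It therefore suffices that BAN and BOR are semi-abelian, that
    epimorphisms of BAN are not pullback stable, and that neither are cokernels
    of BOR.

    In BAN, let d : c_0 -> c_0 divide the n-th entry by n + 1. It is epi since
    its range is dense, but the harmonic sequence y = (1 / (n + 1)) is not in
    its range, so the pullback of d along t |-> t y is 0 -> K.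

    In BOR, every linear space with a family of subsets to be made bounded
    carries a finest locally convex topology of that kind, which is
    bornological; subspaces, quotients, products and pullbacks in BOR have such
    topologies. Let E be the union over n of the polynomials w of
    Y-degree < n in K[X][Y], the unit box of each layer being bounded, and let
    d evaluate at X = 2. As evaluation at 2 maps the unit box of K[X] onto K,
    the quotient topology D on K[Y] is indiscrete. Pull d back along the
    identity B -> D, where B is K[Y] with the supremum norm: a set bounded in
    the pullback has bounded degree and bounded values, so that y |-> y(2),
    which is unbounded on the unit ball of B, is bounded on its image. Hence
    this discontinuous functional on B becomes continuous on the pullback, and
    the pullback of d is not a cokernel. *)

Require Import Defs.
From HB Require Import structures.
From mathcomp Require Import all_boot all_order all_algebra.
From mathcomp Require Import all_classical all_reals all_analysis.
From mathcomp Require Import complex.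
From mathcomp Require Import ring Rstruct.

Set Implicit Arguments.
Unset Strict Implicit.
Unset Printing Implicit Defensive.

Import Order.TTheory GRing.Theory Num.Theory.
Import numFieldNormedType.Exports.

Local Open Scope classical_set_scope.
Local Open Scope ring_scope.

(** * Product categories *)

Section ProductCategoryTheory.
Variables C D : category.
Local Notation CD := (prod_category C D).

Lemma zero_object_prod (X : C) (Y : D) :
  zero_object (C := CD) (X, Y) <-> zero_object X /\ zero_object Y.
Proof.
split=> [zXY|[zX zY] [A B]].
  split=> A.
    have [[[f g] [_ fg]] [[f' g'] [_ fg']]] := zXY (A, Y).
    split; [exists f|exists f']; split=> // h _.
      by have /(congr1 fst) := fg (h, g) I.
    by have /(congr1 fst) := fg' (h, g') I.
  have [[[f g] [_ fg]] [[f' g'] [_ fg']]] := zXY (X, A).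
  split; [exists g|exists g']; split=> // h _.
    by have /(congr1 snd) := fg (f, h) I.
  by have /(congr1 snd) := fg' (f', h) I.
have [[f [_ fE]] [f' [_ fE']]] := zX A.
have [[g [_ gE]] [g' [_ gE']]] := zY B.
split; [exists (f, g)|exists (f', g')]; split=> // -[h1 h2] _.
  by rewrite (fE h1)// (gE h2).
by rewrite (fE' h1)// (gE' h2).
Qed.

Lemma zero_morphism_prod (X Y : CD) (f : Mor X Y) :
  zero_morphism f <-> zero_morphism f.1 /\ zero_morphism f.2.
Proof.
case: f => f1 f2; split=> [[[Z1 Z2] [/zero_object_prod[z1 z2]]]|].
  by move=> [[p1 p2] [[i1 i2] [-> ->]]]; split;
    [exists Z1|exists Z2]; split=> //; do 2!eexists; reflexivity.
move=> /= [[Z1 [z1 [p1 [i1 ->]]]] [Z2 [z2 [p2 [i2 ->]]]]].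
exists (Z1, Z2); split; first exact/zero_object_prod.
by exists (p1, p2), (i1, i2).
Qed.

Lemma mono_prod (X Y : CD) (f : Mor X Y) : mono f.1 -> mono f.2 -> mono f.
Proof.
move=> m1 m2 Z [g1 g2] [h1 h2] [e1 e2].
by rewrite (m1 _ _ _ e1) (m2 _ _ _ e2).
Qed.

Lemma epi_prod (X Y : CD) (f : Mor X Y) : epi f.1 -> epi f.2 -> epi f.
Proof.
move=> m1 m2 Z [g1 g2] [h1 h2] [e1 e2].
by rewrite (m1 _ _ _ e1) (m2 _ _ _ e2).
Qed.

(** Test morphisms out of the first component are completed by the identity of [Y2], which turns
    them into test morphisms of the product. *)
Lemma epi_prod1 (X Y : CD) (f : Mor X Y) : epi f -> epi f.1.
Proof.
case: X Y f => [X1 X2] [Y1 Y2] [f1 f2] ef Z g h gh.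
have := ef (Z, Y2) (g, idm Y2) (h, idm Y2).
by rewrite /= gh => /(_ erefl)/(congr1 fst).
Qed.

Lemma kernel_of_prod (X Y Z : CD) (k : Mor Z X) (f : Mor X Y) :
  kernel_of k.1 f.1 -> kernel_of k.2 f.2 -> kernel_of k f.
Proof.
move=> [z1 u1] [z2 u2]; split; first exact/zero_morphism_prod.
move=> W g /zero_morphism_prod[/u1[v1 [e1 q1]] /u2[v2 [e2 q2]]].
exists (v1, v2); split; first by rewrite /= e1 e2; case: (g).
by move=> [w1 w2] gE; rewrite -gE /= in q1 q2 *; rewrite (q1 w1)// (q2 w2).
Qed.

Lemma cokernel_of_prod (X Y Z : CD) (q : Mor Y Z) (f : Mor X Y) :
  cokernel_of q.1 f.1 -> cokernel_of q.2 f.2 -> cokernel_of q f.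
Proof.
move=> [z1 u1] [z2 u2]; split; first exact/zero_morphism_prod.
move=> W g /zero_morphism_prod[/u1[v1 [e1 q1]] /u2[v2 [e2 q2]]].
exists (v1, v2); split; first by rewrite /= e1 e2; case: (g).
by move=> [w1 w2] gE; rewrite -gE /= in q1 q2 *; rewrite (q1 w1)// (q2 w2).
Qed.

Lemma is_kernel_prod (X Y : CD) (f : Mor X Y) :
  is_kernel f.1 -> is_kernel f.2 -> is_kernel f.
Proof.
move=> [B1 [g1 k1]] [B2 [g2 k2]]; exists (B1, B2), (g1, g2).
exact: kernel_of_prod.
Qed.

Lemma is_cokernel_prod (X Y : CD) (f : Mor X Y) :
  is_cokernel f.1 -> is_cokernel f.2 -> is_cokernel f.
Proof.
move=> [B1 [g1 k1]] [B2 [g2 k2]]; exists (B1, B2), (g1, g2).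
exact: cokernel_of_prod.
Qed.

Lemma additive_category_prod :
  additive_category C -> additive_category D -> additive_category CD.
Proof.
move=> [P [[Z1 z1] bP]] [Q [[Z2 z2] bQ]].
pose add (A B : CD) (f g : Mor A B) : Mor A B :=
  (addm P f.1 g.1, addm Q f.2 g.2).
pose zero (A B : CD) : Mor A B := (zerom P A.1 B.1, zerom Q A.2 B.2).
pose opp (A B : CD) (f : Mor A B) : Mor A B := (oppm P f.1, oppm Q f.2).
have addA A B : associative (add A B).
  by move=> f g h; rewrite /add /= !addmA.
have addC A B : commutative (add A B).
  by move=> f g; rewrite /add addmC (addmC Q).
have add0 A B : left_id (zero A B) (add A B).
  by move=> [f1 f2]; rewrite /add /= !add0m.
have addN A B : left_inverse (zero A B) (opp A B) (add A B).
  by move=> [f1 f2]; rewrite /add /= !addNm.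
have compDl A B E (g h : Mor B E) (f : Mor A B) :
    add _ _ g h \oc f = add _ _ (g \oc f) (h \oc f).
  by rewrite /add /= !compmDl.
have compDr A B E (g : Mor B E) (f h : Mor A B) :
    g \oc add _ _ f h = add _ _ (g \oc f) (g \oc h).
  by rewrite /add /= !compmDr.
exists (PreadditiveStructure addA addC add0 addN compDl compDr); split.
  by exists (Z1, Z2); apply/zero_object_prod.
move=> [A1 A2] [B1 B2].
have [S1 [i1 [j1 [p1 [q1 [e1 e2 e3]]]]]] := bP A1 B1.
have [S2 [i2 [j2 [p2 [q2 [e4 e5 e6]]]]]] := bQ A2 B2.
exists (S1, S2), (i1, i2), (j1, j2), (p1, p2), (q1, q2).
by split; rewrite /= /add /= ?e1 ?e2 ?e3 ?e4 ?e5 ?e6.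
Qed.

Lemma pre_abelian_prod : pre_abelian C -> pre_abelian D -> pre_abelian CD.
Proof.
move=> [aC kC] [aD kD]; split; first exact: additive_category_prod.
move=> [A1 A2] [B1 B2] [f1 f2].
have [[K1 [k1 h1]] [Q1 [q1 g1]]] := kC _ _ f1.
have [[K2 [k2 h2]] [Q2 [q2 g2]]] := kD _ _ f2.
split; first by exists (K1, K2), (k1, k2); exact: kernel_of_prod.
by exists (Q1, Q2), (q1, q2); exact: cokernel_of_prod.
Qed.

Lemma semi_abelian_prod : semi_abelian C -> semi_abelian D -> semi_abelian CD.
Proof.
move=> [[pC lC] [_ rC]] [[pD lD] [_ rD]].
split; split; do ?exact: pre_abelian_prod; move=> [A1 A2] [B1 B2] [f1 f2].
  have [E1 [p1 [i1 [-> m1 c1]]]] := lC _ _ f1.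
  have [E2 [p2 [i2 [-> m2 c2]]]] := lD _ _ f2.
  exists (E1, E2), (p1, p2), (i1, i2).
  by split=> //; [exact: mono_prod|exact: is_cokernel_prod].
have [E1 [p1 [i1 [-> m1 c1]]]] := rC _ _ f1.
have [E2 [p2 [i2 [-> m2 c2]]]] := rD _ _ f2.
exists (E1, E2), (p1, p2), (i1, i2).
by split=> //; [exact: is_kernel_prod|exact: epi_prod].
Qed.

Lemma pullback_square_prod (A B E F : CD) (a : Mor A B) (b : Mor A E)
    (c : Mor B F) (d : Mor E F) :
  pullback_square a.1 b.1 c.1 d.1 -> pullback_square a.2 b.2 c.2 d.2 ->
  pullback_square a b c d.
Proof.
move=> [s1 u1] [s2 u2]; split; first by rewrite /= s1 s2.
move=> X u v [/u1[w1 [[a1 b1] q1]] /u2[w2 [[a2 b2] q2]]].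
exists (w1, w2); split; first by rewrite /= a1 b1 a2 b2; case: (u) (v) => ? ? [].
move=> [w w'] [/= uE vE]; rewrite -uE -vE /= in q1 q2.
by rewrite (q1 w)// (q2 w').
Qed.

End ProductCategoryTheory.

Lemma pullback_square_id (C : category) (X : C) :
  pullback_square (idm X) (idm X) (idm X) (idm X).
Proof.
split=> // Y u v; rewrite !comp1m => ->; exists v.
by split=> [|w [<- _]]; rewrite !comp1m.
Qed.

(** A square in [C] is paired with the constant identity square on [Y], which is a pullback whose
    sides are epi. Any object [Y] of [D] serves. *)
Lemma stable_under_pullback_epi_prod (C D : category) (Y : D) :
  stable_under_pullback (C := prod_category C D) (@epi _) ->
  stable_under_pullback (C := C) (@epi _).
Proof.
move=> st A B E F a b c d sq ed.
apply: (@epi_prod1 C D (A, Y) (B, Y) (a, idm Y)).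
apply: (st (A, Y) (B, Y) (E, Y) (F, Y) _ (b, idm Y) (c, idm Y) (d, idm Y)).
  by apply: pullback_square_prod => //=; exact: pullback_square_id.
by apply: epi_prod => //= Z g h; rewrite !compm1.
Qed.

Lemma cokernel_of_id (C : category) (Z : C) :
  zero_object Z -> cokernel_of (idm Z) (idm Z).
Proof.
move=> zZ; split=> [|X g _].
  by exists Z; split=> //; exists (idm Z), (idm Z).
by exists g; split=> [|h <-]; rewrite compm1.
Qed.

(** Here the other component is filled with a zero object [Z]: its identity is a cokernel, and every
    test morphism in [D] extends by [idm Z] to one in the product. *)
Lemma stable_under_pullback_cokernel_prod (C D : category) (Z : C) :
  zero_object Z ->
  stable_under_pullback (C := prod_category C D) (@is_cokernel _) ->
  stable_under_pullback (C := D) (@is_cokernel _).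
Proof.
move=> zZ st A B E F a b c d sq [G [f df]].
have [] := st (Z, A) (Z, B) (Z, E) (Z, F) (idm Z, a) (idm Z, b) (idm Z, c)
  (idm Z, d).
- by apply: pullback_square_prod => //=; exact: pullback_square_id.
- exists (Z, G), (idm Z, f); apply: cokernel_of_prod => //=.
  exact: cokernel_of_id.
move=> [G1 G2] [[f1 f2] [z u]]; exists G2, f2.
have [/= _ z2] := (zero_morphism_prod _).1 z; split=> // X g zg.
(* The composite of [idm Z] with [f1] is zero because it factors through [Z], so the pair is a
   legitimate test morphism. *)
have [|[w1 w2] [[_ e] q]] := u (Z, X) (idm Z, g).
  apply/zero_morphism_prod; split=> //=.
  by exists Z; split=> //; exists f1, (idm Z); rewrite !comp1m.
exists w2; split=> // w wE.
by have /(congr1 snd) := q (idm Z, w) (congr2 pair (comp1m _) wE).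
Qed.

(** * Full subcategories of locally convex spaces *)

Section LinearContinuousMaps.
Variable K : numFieldType.
Implicit Types E F G : tvsType K.

Lemma linear_fun0 (V W : lmodType K) (g : V -> W) : linear g -> g 0 = 0.
Proof. by move=> /(_ (-1) 0 0); rewrite scaler0 addr0 scaleN1r addNr. Qed.

Lemma linear_funZ (V W : lmodType K) (g : V -> W) : linear g ->
  forall a x, g (a *: x) = a *: g x.
Proof. by move=> lg a x; have := lg a x 0; rewrite (linear_fun0 lg) !addr0. Qed.

Lemma linear_funD (V W : lmodType K) (g : V -> W) : linear g ->
  forall x y, g (x + y) = g x + g y.
Proof. by move=> lg x y; have := lg 1 x y; rewrite !scale1r. Qed.

Lemma lcm0 E F (f : linear_continuous_map E F) : f 0 = 0.
Proof. exact: linear_fun0 (lcm_linear f). Qed.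

Lemma lcmD E F (f : linear_continuous_map E F) x y : f (x + y) = f x + f y.
Proof. exact: linear_funD (lcm_linear f) _ _. Qed.

Lemma lcmZ E F (f : linear_continuous_map E F) a x : f (a *: x) = a *: f x.
Proof. exact: linear_funZ (lcm_linear f) _ _. Qed.

Lemma lcmB E F (f : linear_continuous_map E F) x y : f (x - y) = f x - f y.
Proof. by rewrite -[in LHS]scaleN1r lcmD lcmZ scaleN1r. Qed.

Lemma lcm_ext E F (f g : linear_continuous_map E F) : f =1 g -> f = g.
Proof. by move=> fg; apply/linear_continuous_map_eq/funext. Qed.

Lemma lcm_add_linear E F (f g : linear_continuous_map E F) :
  linear (fun x => f x + g x).
Proof. by move=> a x y; rewrite !lcm_linear scalerDr addrACA. Qed.

Lemma lcm_add_continuous E F (f g : linear_continuous_map E F) :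
  continuous (fun x => f x + g x).
Proof.
move=> x; apply: (@continuous_comp _ _ _ (fun x => (f x, g x))
  (fun y : F * F => y.1 + y.2)); last exact: add_continuous.
by apply: cvg_pair; exact: lcm_continuous.
Qed.

Definition lcm_add E F (f g : linear_continuous_map E F) :=
  LinearContinuousMap (lcm_add_linear f g) (@lcm_add_continuous _ _ f g).

Lemma lcm_zero_linear E F : linear (fun _ : E => 0 : F).
Proof. by move=> a x y; rewrite scaler0 addr0. Qed.

Definition lcm_zero E F : linear_continuous_map E F :=
  @LinearContinuousMap _ E F _ (@lcm_zero_linear E F) (fun _ => cvg_cst _).

Lemma lcm_opp_linear E F (f : linear_continuous_map E F) :
  linear (fun x => - f x).
Proof. by move=> a x y; rewrite lcm_linear opprD scalerN. Qed.

Lemma lcm_opp_continuous E F (f : linear_continuous_map E F) :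
  continuous (fun x => - f x).
Proof.
move=> x; apply: (@continuous_comp _ _ _ f (-%R)); first exact: lcm_continuous.
exact: opp_continuous.
Qed.

Definition lcm_opp E F (f : linear_continuous_map E F) :=
  LinearContinuousMap (lcm_opp_linear f) (@lcm_opp_continuous _ _ f).

Definition linear_subspace (V : lmodType K) (S : set V) : Prop :=
  S 0 /\ forall a x y, S x -> S y -> S (a *: x + y).

Lemma linear_subspace_bigcap (V : lmodType K) (P : set (set V)) :
  (forall S, P S -> linear_subspace S) ->
  linear_subspace (\bigcap_(S in P) S).
Proof.
move=> sP; split=> [S /sP[]//|a x y Sx Sy S PS].
by have [_] := sP _ PS; apply; [exact: Sx|exact: Sy].
Qed.

Lemma linear_subspace_ker E F (f : linear_continuous_map E F) :
  linear_subspace [set x | f x = 0].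
Proof.
by split=> [|a x y /= fx fy]; rewrite /= ?lcm0// lcm_linear fx fy scaler0 addr0.
Qed.

End LinearContinuousMaps.

(** * A criterion for full subcategories of locally convex spaces to be semi-abelian *)

Section FullSubcategory.
Variables (K : numFieldType) (J : Type) (F : J -> tvsType K).
Let C : category := full_subcategory (C := LCS K) F.
Local Notation Hom i j := (linear_continuous_map (F i) (F j)).

(** This is the kernel of any morphism that vanishes exactly on [S], described by elements. The
    topology of [F j] enters only through the lifting property, so it may be finer than the subspace
    topology. *)
Definition strict_sub i (S : set (F i)) j (m : Hom j i) : Prop :=
  [/\ injective m, forall x, S (m x), forall y, S y -> exists x, m x = y &
      forall k (u : Hom k i), (forall x, S (u x)) ->
        exists v : Hom k j, forall x, m (v x) = u x].

(** Dually, this is the quotient by [S], with its topology encoded by the descent of morphisms that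
    vanish on [S]. *)
Definition strict_quo i (S : set (F i)) j (q : Hom i j) : Prop :=
  [/\ forall y, exists x, q x = y, forall x, q x = 0 <-> S x &
      forall k (u : Hom i k), (forall x, S x -> u x = 0) ->
        exists v : Hom j k, forall x, v (q x) = u x].

Lemma full_comp_ext (i j k : C) (g g' : Mor j k) (f f' : Mor i j) :
  g \oc f = g' \oc f' <->
  forall x, (g : Hom j k) ((f : Hom i j) x) = (g' : Hom j k) ((f' : Hom i j) x).
Proof.
split=> [+ x|gf]; last exact/lcm_ext.
by move=> /(congr1 (fun h : Hom i k => h x)).
Qed.

Lemma mono_injective (i j : C) (f : Mor i j) :
  injective (f : Hom i j) -> mono f.
Proof. by move=> fi k g h /full_comp_ext gh; apply: lcm_ext => x; apply/fi/gh. Qed.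

Lemma full_zero_object (z : C) : zero_object z <-> forall x : F z, x = 0.
Proof.
split=> [/(_ z)[[f [_ fE]] _] x|z0 i].
  have := congr1 (fun h : Hom z z => h x) (etrans (esym (fE (lcm_id (F z)) I))
    (fE (lcm_zero (F z) (F z)) I)).
  by [].
split; [exists (lcm_zero (F z) (F i))|exists (lcm_zero (F i) (F z))];
  split=> // g _; apply: lcm_ext => x /=; last exact/esym/z0.
by rewrite (z0 x); exact/esym/(@lcm0 _ (F z) (F i)).
Qed.

Hypothesis has_zero : exists z : C, zero_object z.

Lemma full_zero_morphism (i j : C) (f : Mor i j) :
  zero_morphism f <-> forall x, (f : Hom i j) x = 0.
Proof.
split=> [[z [/full_zero_object z0 [p [m ->]]]] x|f0].
  have -> : (m \oc p : Hom i j) x = (m : Hom z j) ((p : Hom i z) x) by [].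
  by rewrite (z0 ((p : Hom i z) x)) (@lcm0 _ (F z) (F j)).
have [z z0] := has_zero; exists z; split=> //.
exists (lcm_zero (F i) (F z)), (lcm_zero (F z) (F j)).
by apply: lcm_ext => x; rewrite f0.
Qed.

Lemma strict_sub_kernel_of (i j k : C) (f : Mor i k) (m : Mor j i) :
  strict_sub [set x | (f : Hom i k) x = 0] m -> kernel_of m f.
Proof.
move=> [mi Sm _ lift]; split; first exact/full_zero_morphism.
move=> X g /full_zero_morphism fg; have [v mv] := lift _ g fg.
exists v; split; first exact: lcm_ext.
by move=> w mw; apply: lcm_ext => x; apply: mi; rewrite mv -mw.
Qed.

(** The set [S] may be larger than the range of [f], for instance its closure; it suffices that
    morphisms cannot tell the two apart. *)
Lemma strict_quo_cokernel_of (i j k : C) (f : Mor k i) (q : Mor i j)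
    (S : set (F i)) : strict_quo S q ->
  (forall x, S ((f : Hom k i) x)) ->
  (forall l (u : Hom i l), (forall x, u ((f : Hom k i) x) = 0) ->
     forall x, S x -> u x = 0) ->
  cokernel_of q f.
Proof.
move=> [qs qS desc] fS Sf; split; first by apply/full_zero_morphism => x; apply/qS.
move=> X g /full_zero_morphism gf; have [v vq] := desc _ g (Sf _ g gf).
exists v; split; first exact: lcm_ext.
move=> w wq; apply: lcm_ext => y; have [x <-] := qs y.
by rewrite vq -wq.
Qed.

Lemma strict_quo_is_cokernel (i j k : C) (S : set (F i)) (m : Mor k i)
    (q : Mor i j) : strict_sub S m -> strict_quo S q -> is_cokernel q.
Proof.
move=> [_ mS Sm _] qS; exists k, m; apply: strict_quo_cokernel_of qS mS _.
by move=> l u um x /Sm[y <-].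
Qed.

(** Abstract closedness lets both categories share one proof: for Banach spaces it is closedness in
    norm, for bornological spaces every set counts as closed. *)
Variable closed_sub : forall i, set (F i) -> Prop.
Arguments closed_sub {i}.

Hypothesis closed_sub_bigcap : forall i (P : set (set (F i))),
  (forall S, P S -> closed_sub S) -> closed_sub (\bigcap_(S in P) S).
Hypothesis closed_sub_ker : forall i j (f : Hom i j),
  closed_sub [set x | f x = 0].
Hypothesis has_sub : forall i (S : set (F i)), linear_subspace S ->
  closed_sub S -> exists j (m : Hom j i), strict_sub S m /\
    forall T : set (F j), closed_sub T -> closed_sub (m @` T).
Hypothesis has_quo : forall i (S : set (F i)), linear_subspace S ->
  closed_sub S -> exists j (q : Hom i j), strict_quo S q.
Hypothesis has_biproduct : forall i j, exists s (m1 : Hom i s) (m2 : Hom j s)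
    (p1 : Hom s i) (p2 : Hom s j),
  [/\ forall x, p1 (m1 x) = x, forall y, p2 (m2 y) = y &
      forall z, m1 (p1 z) + m2 (p2 z) = z].

(** The smallest closed subspace containing [A]. Cokernels are quotients by the span of a range, and
    kernels of morphisms are closed, so a morphism that kills the range kills its span. *)
Let span i (A : set (F i)) : set (F i) := \bigcap_(S in
  [set S | [/\ linear_subspace S, closed_sub S & A `<=` S]]) S.

Let span_subspace i (A : set (F i)) : linear_subspace (span A).
Proof. by apply: linear_subspace_bigcap => S []. Qed.

Let span_closed i (A : set (F i)) : closed_sub (span A).
Proof. by apply: closed_sub_bigcap => S []. Qed.

Let sub_span i (A : set (F i)) : A `<=` span A.
Proof. by move=> x Ax S [_ _]; exact. Qed.

Let span_min i (A S : set (F i)) : linear_subspace S -> closed_sub S ->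
  A `<=` S -> span A `<=` S.
Proof. by move=> lS cS AS x; apply. Qed.

Let full_additive : additive_category C.
Proof.
pose add (A B : C) (f g : Mor A B) : Mor A B := @lcm_add K (F A) (F B) f g.
pose zero (A B : C) : Mor A B := @lcm_zero K (F A) (F B).
pose opp (A B : C) (f : Mor A B) : Mor A B := @lcm_opp K (F A) (F B) f.
have addA A B : associative (add A B).
  by move=> f g h; apply: lcm_ext => x; rewrite /= addrA.
have addC A B : commutative (add A B).
  by move=> f g; apply: lcm_ext => x; rewrite /= addrC.
have add0 A B : left_id (zero A B) (add A B).
  by move=> f; apply: lcm_ext => x; rewrite /= add0r.
have addN A B : left_inverse (zero A B) (opp A B) (add A B).
  by move=> f; apply: lcm_ext => x; rewrite /= addNr.
have compDl A B E (g h : Mor B E) (f : Mor A B) :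
    add _ _ g h \oc f = add _ _ (g \oc f) (h \oc f).
  exact: lcm_ext.
have compDr A B E (g : Mor B E) (f h : Mor A B) :
    g \oc add _ _ f h = add _ _ (g \oc f) (g \oc h).
  by apply: lcm_ext => x /=; exact: (@lcmD _ (F B) (F E)).
exists (PreadditiveStructure addA addC add0 addN compDl compDr); split=> //.
move=> i j; have [s [m1 [m2 [p1 [p2 [e1 e2 e3]]]]]] := has_biproduct i j.
by exists s, m1, m2, p1, p2; split; exact: lcm_ext.
Qed.

Let full_pre_abelian : pre_abelian C.
Proof.
split; first exact: full_additive.
move=> i j f; split.
  have [k [m [mS _]]] := has_sub (linear_subspace_ker (f : Hom i j))
    (closed_sub_ker (f : Hom i j)).
  by exists k, m; exact: strict_sub_kernel_of.
have [k [q qS]] := has_quo (span_subspace (range (f : Hom i j)))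
  (@span_closed _ _).
exists k, q; apply: strict_quo_cokernel_of qS _ _.
  by move=> x; apply: sub_span; exists x.
move=> l u uf; apply: span_min; first exact: linear_subspace_ker.
  exact: closed_sub_ker.
by move=> _ [x _ <-]; exact: uf.
Qed.

Lemma full_semi_abelian : semi_abelian C.
Proof.
split; split; do ?exact: full_pre_abelian; move=> i j f.
  (* Left half: [f] factors through the quotient by its kernel, on which it becomes injective. *)
  have lS := linear_subspace_ker (f : Hom i j).
  have [k [m [mS _]]] := has_sub lS (closed_sub_ker (f : Hom i j)).
  have [l [q qS]] := has_quo lS (closed_sub_ker (f : Hom i j)).
  have [qs qker desc] := qS; have [v vq] := desc _ (f : Hom i j) (fun=> id).
  exists l, q, v; split; first by apply: lcm_ext => x; rewrite /= vq.
    apply: mono_injective => a b; have [x <-] := qs a; have [y <-] := qs b.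
    rewrite !vq => /eqP; rewrite -subr_eq0 -lcmB => /eqP/qker.
    by rewrite lcmB => /eqP; rewrite subr_eq0 => /eqP.
  exact: strict_quo_is_cokernel mS qS.
(* Right half: [f] factors through the closed span of its range, which is the kernel of the quotient
   by that span. *)
have lS := span_subspace (range (f : Hom i j)).
have cS := @span_closed _ (range (f : Hom i j)).
have [k [m [mS mcl]]] := has_sub lS cS.
have [l [q [qs qS desc]]] := has_quo lS cS.
have fS x : span (range (f : Hom i j)) ((f : Hom i j) x).
  by apply: sub_span; exists x.
have [mi Sm ms lift] := mS; have [v mv] := lift _ (f : Hom i j) fS.
exists k, v, m; split; first by apply: lcm_ext => x; rewrite /= mv.
  exists l, q; apply: strict_sub_kernel_of; split=> //.
  - by move=> x; exact/qS.
  - by move=> y /qS/ms.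
  - by move=> n u qu; apply: lift => x; exact/qS/qu.
(* The corestriction [v] is epi: if [g] and [h] agree on its range, the image under [m] of the
   kernel of [g - h] is a closed subspace containing the range of [f], hence the whole span. *)
move=> n g h /full_comp_ext gh; apply: lcm_ext => x.
pose d := lcm_add (g : Hom k n) (lcm_opp (h : Hom k n)).
suff : [set m x | x in [set x | d x = 0]] (m x).
  by move=> [y /= dy /mi <-]; exact: subr0_eq dy.
have := Sm x; apply: span_min.
- split=> [|a _ _ [y dy <-] [z dz <-]]; first by exists 0; exact: lcm0.
  exists (a *: y + z); last by rewrite lcm_linear.
  have [_] := linear_subspace_ker d; exact.
- exact/mcl/closed_sub_ker.
- move=> _ [y _ <-]; exists ((v : Hom i k) y); last exact: mv.
  by rewrite /= -(gh y) subrr.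
Qed.

End FullSubcategory.

(** * Submodules and quotients *)

Section Submodule.
Variables (K : numFieldType) (V : lmodType K) (S : set V).

Definition submodule (_ : linear_subspace S) : Type := {x : V | S x}.

Variable lS : linear_subspace S.
Local Notation W := (submodule lS).

HB.instance Definition _ := gen_eqMixin W.
HB.instance Definition _ := gen_choiceMixin W.

Definition submodule_val (w : W) : V := sval w.

Lemma submodule_valP (w : W) : S (submodule_val w).
Proof. exact: svalP. Qed.

Lemma submodule_val_inj : injective submodule_val.
Proof. by move=> [x Sx] [y Sy]; exact: eq_exist. Qed.

Let S0 : S 0 := lS.1.
Let SD x y : S x -> S y -> S (x + y).
Proof. by move=> Sx Sy; have := lS.2 1 _ _ Sx Sy; rewrite scale1r. Qed.
Let SZ a x : S x -> S (a *: x).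
Proof. by move=> Sx; have := lS.2 a _ _ Sx S0; rewrite addr0. Qed.
Let SN x : S x -> S (- x).
Proof. by rewrite -scaleN1r; exact: SZ. Qed.

Let zero : W := exist _ 0 S0.
Let add (x y : W) : W := exist _ _ (SD (svalP x) (svalP y)).
Let opp (x : W) : W := exist _ _ (SN (svalP x)).
Let scale a (x : W) : W := exist _ _ (SZ a (svalP x)).

Let addA : associative add.
Proof. by move=> x y z; apply: submodule_val_inj => /=; exact: addrA. Qed.
Let addC : commutative add.
Proof. by move=> x y; apply: submodule_val_inj => /=; exact: addrC. Qed.
Let add0 : left_id zero add.
Proof. by move=> x; apply: submodule_val_inj => /=; exact: add0r. Qed.
Let addN : left_inverse zero opp add.
Proof. by move=> x; apply: submodule_val_inj => /=; exact: addNr. Qed.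

HB.instance Definition _ := GRing.isZmodule.Build W addA addC add0 addN.

Let scaleA a b (x : W) : scale a (scale b x) = scale (a * b) x.
Proof. by apply: submodule_val_inj => /=; exact: scalerA. Qed.
Let scale1 : left_id 1 scale.
Proof. by move=> x; apply: submodule_val_inj => /=; exact: scale1r. Qed.
Let scaleDr : right_distributive scale +%R.
Proof. by move=> a x y; apply: submodule_val_inj => /=; exact: scalerDr. Qed.
Let scaleDl (x : W) : {morph scale^~ x : a b / a + b}.
Proof. by move=> a b; apply: submodule_val_inj => /=; exact: scalerDl. Qed.

HB.instance Definition _ :=
  GRing.Zmodule_isLmodule.Build K W scaleA scale1 scaleDr scaleDl.

Lemma submodule_val_linear : linear submodule_val.
Proof. by []. Qed.

HB.instance Definition _ :=
  GRing.isLinear.Build K W V _ submodule_val submodule_val_linear.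

Lemma submodule_val_surj x : S x -> exists w, submodule_val w = x.
Proof. by move=> Sx; exists (exist _ x Sx). Qed.

End Submodule.

Section Quotient.
Variables (K : numFieldType) (V : lmodType K) (S : set V).

(* The canonical representative of the class of x; it depends only on the set
   x + S, so a class is identified with the unique representative in it. *)
Definition coset_repr (x : V) : V := xget 0 [set y | S (x - y)].

Definition quotient_module (_ : linear_subspace S) : Type :=
  {x : V | coset_repr x = x}.

Variable lS : linear_subspace S.
Local Notation W := (quotient_module lS).

HB.instance Definition _ := gen_eqMixin W.
HB.instance Definition _ := gen_choiceMixin W.

Let S0 : S 0 := lS.1.
Let SD x y : S x -> S y -> S (x + y).
Proof. by move=> Sx Sy; have := lS.2 1 _ _ Sx Sy; rewrite scale1r. Qed.
Let SZ a x : S x -> S (a *: x).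
Proof. by move=> Sx; have := lS.2 a _ _ Sx S0; rewrite addr0. Qed.
Let SN x : S x -> S (- x).
Proof. by rewrite -scaleN1r; exact: SZ. Qed.

Let coset_reprP x : S (x - coset_repr x).
Proof.
apply: (@xgetPex _ 0 [set y | S (x - y)]); exists x => /=.
by rewrite subrr; exact: S0.
Qed.

Let coset_repr_eq x y : coset_repr x = coset_repr y <-> S (x - y).
Proof.
split=> [xy|Sxy].
  rewrite -(subrK (coset_repr x) x) {2}xy -addrA; apply: SD => //.
  by rewrite -opprB; exact/SN.
congr xget; apply/seteqP; split=> z /= Sz.
  by rewrite -(subrK x y) -addrA; apply: SD => //; rewrite -opprB; exact: SN.
by rewrite -(subrK y x) -addrA; apply: SD.
Qed.

Let coset_reprK x : coset_repr (coset_repr x) = coset_repr x.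
Proof. by apply/coset_repr_eq; rewrite -opprB; exact/SN. Qed.

Definition quotient_pi (x : V) : W := exist _ (coset_repr x) (coset_reprK x).

Lemma quotient_pi_eq x y : quotient_pi x = quotient_pi y <-> S (x - y).
Proof.
rewrite -coset_repr_eq; split=> [/(congr1 sval)//|xy].
exact: eq_exist.
Qed.

Let reprK (w : W) : quotient_pi (sval w) = w.
Proof. by case: w => x xE; exact: eq_exist. Qed.

Lemma quotient_pi_surj (w : W) : exists x, quotient_pi x = w.
Proof. by exists (sval w). Qed.

Let piE x : S (x - sval (quotient_pi x)).
Proof. exact: coset_reprP. Qed.

Let zero : W := quotient_pi 0.
Let add (x y : W) : W := quotient_pi (sval x + sval y).
Let opp (x : W) : W := quotient_pi (- sval x).
Let scale a (x : W) : W := quotient_pi (a *: sval x).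

Let addE x y : add (quotient_pi x) (quotient_pi y) = quotient_pi (x + y).
Proof.
apply/quotient_pi_eq; rewrite -opprB; apply: SN.
by rewrite opprD addrACA; exact: SD.
Qed.

Let oppE x : opp (quotient_pi x) = quotient_pi (- x).
Proof. by apply/quotient_pi_eq; rewrite opprK addrC. Qed.

Let scaleE a x : scale a (quotient_pi x) = quotient_pi (a *: x).
Proof.
by apply/quotient_pi_eq; rewrite -scalerBr; apply: SZ; rewrite -opprB; exact: SN.
Qed.

Let addA : associative add.
Proof.
move=> x y z; rewrite -(reprK x) -(reprK y) -(reprK z) !addE.
by rewrite addrA.
Qed.
Let addC : commutative add.
Proof. by move=> x y; rewrite /add addrC. Qed.
Let add0 : left_id zero add.
Proof. by move=> x; rewrite -(reprK x) addE add0r. Qed.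
Let addN : left_inverse zero opp add.
Proof. by move=> x; rewrite -(reprK x) oppE addE addNr. Qed.

HB.instance Definition _ := GRing.isZmodule.Build W addA addC add0 addN.

Let scaleA a b (x : W) : scale a (scale b x) = scale (a * b) x.
Proof. by rewrite -(reprK x) !scaleE scalerA. Qed.
Let scale1 : left_id 1 scale.
Proof. by move=> x; rewrite -(reprK x) scaleE scale1r. Qed.
Let scaleDr : right_distributive scale +%R.
Proof.
move=> a x y; rewrite -(reprK x) -(reprK y).
by rewrite (scaleE a) (scaleE a) -[LHS]/(scale a (add _ _)) !addE scaleE scalerDr.
Qed.
Let scaleDl (x : W) : {morph scale^~ x : a b / a + b}.
Proof.
move=> a b; rewrite -(reprK x) !scaleE scalerDl.
by rewrite -[RHS]/(add _ _) addE.
Qed.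

HB.instance Definition _ :=
  GRing.Zmodule_isLmodule.Build K W scaleA scale1 scaleDr scaleDl.

Lemma quotient_pi_linear : linear quotient_pi.
Proof. by move=> a x y; rewrite -addE -scaleE. Qed.

HB.instance Definition _ :=
  GRing.isLinear.Build K V W _ quotient_pi quotient_pi_linear.

Lemma quotient_pi_eq0 x : quotient_pi x = 0 <-> S x.
Proof. by have := quotient_pi_eq x 0; rewrite subr0. Qed.

End Quotient.

(** * Bounded sets and bornological spaces *)

Section Disks.
Variables (K : numFieldType) (V : lmodType K).
Implicit Types (A B U : set V) (x y : V) (c : K).

(** The formula of [absolutely_convex], on a bare module: disks are used below to construct a
    topology. *)
Definition disk A : Prop :=
  forall x y (a b : K), A x -> A y -> `|a| + `|b| <= 1 ->
    A (a *: x + b *: y).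

(* For a disk A this is equivalent to Defs.absorbs, with c the inverse of the
   scaling factor used there. *)
Definition swallows A B : Prop := exists2 c, 0 < c & forall x, B x -> A (c *: x).

Lemma disk_scale A a x : disk A -> A x -> `|a| <= 1 -> A (a *: x).
Proof.
move=> dA Ax a1; have := dA x x a 0 Ax Ax.
by rewrite normr0 addr0 scale0r addr0; exact.
Qed.

Lemma disk0 A x : disk A -> A x -> A 0.
Proof. by move=> dA /(disk_scale dA) => /(_ 0); rewrite normr0 scale0r; exact. Qed.

Lemma diskI A B : disk A -> disk B -> disk (A `&` B).
Proof. by move=> dA dB x y a b [? ?] [? ?] ?; split; [exact: dA|exact: dB]. Qed.

Lemma disk_dilate A c : disk A -> disk [set x | A (c *: x)].
Proof.
move=> dA x y a b /= Ax Ay ab; rewrite scalerDr !scalerA ![c * _]mulrC -!scalerA.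
exact: dA.
Qed.

Lemma swallows_le A B c d : disk A -> 0 < d -> d <= c ->
  (forall x, B x -> A (c *: x)) -> forall x, B x -> A (d *: x).
Proof.
move=> dA d0 dc AB x /AB Acx; have c0 := lt_le_trans d0 dc.
rewrite -[d](divfK (lt0r_neq0 c0)) -scalerA; apply: disk_scale => //.
by rewrite ger0_norm ?divr_ge0 ?(ltW d0) ?(ltW c0)// ler_pdivrMr// mul1r.
Qed.

Lemma swallowsI A A' B : disk A -> disk A' -> swallows A B -> swallows A' B ->
  swallows (A `&` A') B.
Proof.
move=> dA dA' [c c0 AB] [c' c0' AB'].
have cc0 : 0 < c + c' by rewrite addr_gt0.
(* A positive number below both [c] and [c'], obtained without comparing them. *)
have p0 : 0 < c * c' / (c + c') by rewrite divr_gt0 ?mulr_gt0.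
exists (c * c' / (c + c')) => // x Bx; split.
  apply: (swallows_le dA p0 _ AB Bx).
  by rewrite ler_pdivrMr// ler_pM2l// lerDr ltW.
apply: (swallows_le dA' p0 _ AB' Bx).
by rewrite ler_pdivrMr// mulrC ler_pM2l// lerDl ltW.
Qed.

Lemma swallows_dilate A B c : 0 < c -> swallows A B ->
  swallows [set x | A (c *: x)] B.
Proof.
move=> c0 [d d0 AB]; exists (d / c); first by rewrite divr_gt0.
by move=> x /AB /=; rewrite scalerA mulrC divfK// lt0r_neq0.
Qed.

End Disks.

Lemma disk_preimage (K : numFieldType) (V W : lmodType K) (g : W -> V)
    (A : set V) : linear g -> disk A ->
  disk (g @^-1` A).
Proof.
move=> lg dA x y a b /= Ax Ay ab.
by rewrite lg (linear_funZ lg); exact: dA.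
Qed.

Section Boundedness.
Variable K : numFieldType.
Implicit Types E F : tvsType K.

Lemma nbhs_shift E (x : E) (U : set E) :
  nbhs x U <-> nbhs (0 : E) [set y | U (x + y)].
Proof.
split=> [/(nbhsB (- x))|/(nbhsT x)].
  rewrite addNr; apply: filterS => _ [y Uy <-] /=; by rewrite addNKr.
by apply: filterS => _ [y Uy <-].
Qed.

Lemma linear0_continuous E F (g : E -> F) : linear g ->
  (forall U, nbhs (0 : F) U -> nbhs (0 : E) (g @^-1` U)) -> continuous g.
Proof.
move=> lg g0 x U /nbhs_shift Ux; apply/nbhs_shift.
apply: filterS (g0 _ Ux) => y /=.
by have := lg 1 x y; rewrite !scale1r => ->.
Qed.

Lemma nbhs_swallows_point E (U : set E) (x : E) : nbhs (0 : E) U ->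
  swallows U [set x].
Proof.
move=> U0; have /= := @scale_continuous K E (0, x) U; rewrite scale0r.
move=> /(_ U0) [[A B] [/= /nbhs_normP[e /= e0 eA] Bx] AB].
exists (e / 2); first by rewrite divr_gt0.
move=> _ ->; apply: (AB (e / 2, x)); split; last exact: nbhs_singleton.
apply: eA; rewrite /= sub0r normrN gtr0_norm ?divr_gt0//.
by rewrite ltr_pdivrMr// ltr_pMr// ltr1n.
Qed.

Lemma convex_setE (V : lmodType K) (b : set V) : convex_set b ->
  forall x y t, b x -> b y -> 0 <= t <= 1 -> b (t *: x + (1 - t) *: y).
Proof.
move=> cb x y t /mem_set bx /mem_set b_y /andP[t0 t1].
by have := cb x y (Itv01 t0 t1) bx b_y => /set_mem.
Qed.

(* The balanced core of a convex neighbourhood is absolutely convex. *)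
Lemma nbhs_disk E (U : set E) : nbhs (0 : E) U ->
  exists W : set E, [/\ disk W, nbhs (0 : E) W & W `<=` U].
Proof.
have [B cB [Bo Bb]] := @locally_convex K E.
move=> /Bb[b [Bbb b0] bU]; have cb := convex_setE (cB _ (mem_set Bbb)).
have nb : nbhs (0 : E) b by apply: open_nbhs_nbhs; split=> //; exact: Bo.
pose W : set E := [set x | forall t : K, `|t| <= 1 -> b (t *: x)].
have WZ x (s : K) : W x -> `|s| <= 1 -> W (s *: x).
  move=> Wx s1 t t1; rewrite scalerA; apply: Wx.
  by rewrite normrM mulr_ile1.
exists W; split; last by move=> x /(_ 1); rewrite normr1 scale1r => /(_ _)/bU; exact.
- move=> x y a c Wx Wy ac t t1; rewrite scalerDr !scalerA.
  have [->|a0] := eqVneq a 0.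
    rewrite mulr0 scale0r add0r; apply: Wy; rewrite normrM mulr_ile1//.
    by apply: le_trans ac; rewrite lerDr.
  have [->|c0] := eqVneq c 0.
    rewrite mulr0 scale0r addr0; apply: Wx; rewrite normrM mulr_ile1//.
    by apply: le_trans ac; rewrite lerDl.
  (* The point is a convex combination with weights [|a| / s] and [|c| / s] of multiples of [x] and
     [y] by scalars of modulus [|t| s <= 1]. The cases [a = 0] and [c = 0] were split off because of
     the divisions. *)
  set s := `|a| + `|c| in ac *.
  have s0 : 0 < s by rewrite addr_gt0 ?normr_gt0.
  have aE : t * a = (`|a| / s) * (t * s * (a / `|a|)).
    by field; rewrite ?normr_eq0 ?a0 ?lt0r_neq0.
  have cE : t * c = (1 - `|a| / s) * (t * s * (c / `|c|)).
    have -> : 1 - `|a| / s = `|c| / s.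
      by rewrite /s; field; rewrite -/s lt0r_neq0.
    by field; rewrite ?normr_eq0 ?c0 ?lt0r_neq0.
  rewrite aE cE -(scalerA (`|a| / s)) -(scalerA (1 - _)); apply: cb.
  + apply: Wx; rewrite normrM normf_div normr_id divff ?normr_eq0// mulr1.
    by rewrite normrM mulr_ile1// gtr0_norm.
  + apply: Wy; rewrite normrM normf_div normr_id divff ?normr_eq0// mulr1.
    by rewrite normrM mulr_ile1// gtr0_norm.
  + by rewrite divr_ge0 ?(ltW s0)//= ler_pdivrMr// mul1r lerDl.
(* Continuity of scaling at the origin gives [e] and [N] such that scalars of modulus below [e] map
   [N] into [b]; hence [W] contains [(e / 2) N]. *)
- have /= := @scale_continuous K E (0, 0) b; rewrite scale0r.
  move=> /(_ nb) [[A N] [/= /nbhs_normP[e /= e0 eA] N0] AN].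
  have e20 : 0 < e / 2 by rewrite divr_gt0.
  apply: filterS (nbhs0Z (lt0r_neq0 e20) N0) => _ [x Nx <-] t t1; rewrite scalerA.
  apply: (AN (t * (e / 2), x)); split=> //=; apply: eA => /=.
  rewrite sub0r normrN normrM (gtr0_norm e20).
  apply: (@le_lt_trans _ _ (e / 2)).
    by rewrite ler_piMl// ltW.
  by rewrite ltr_pdivrMr// ltr_pMr// ltr1n.
Qed.

Lemma absorbs_swallows E (A B : set E) : absorbs A B -> swallows A B.
Proof.
move=> [r r0 AB]; exists r^-1; rewrite ?invr_gt0// => x /(AB r).
rewrite gtr0_norm// lexx => /(_ isT)[y Ay <-].
by rewrite scalerA mulVf ?lt0r_neq0// scale1r.
Qed.

Lemma swallows_absorbs E (A B : set E) : disk A -> swallows A B -> absorbs A B.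
Proof.
move=> dA [c c0 AB]; exists c^-1; first by rewrite invr_gt0.
move=> t ct x /AB Ax; have t0 : 0 < `|t| by rewrite (lt_le_trans _ ct) ?invr_gt0.
exists (t^-1 *: x); last by rewrite scalerA divff ?scale1r// -normr_gt0.
rewrite -[t^-1](divfK (lt0r_neq0 c0)) -scalerA; apply: disk_scale => //.
rewrite normrM !normfV (gtr0_norm c0) -invfM invf_le1 ?mulr_gt0//.
by rewrite -ler_pdivrMr// mul1r.
Qed.

Lemma vN_boundedP E (B : set E) :
  vN_bounded B <-> forall U, nbhs (0 : E) U -> disk U -> swallows U B.
Proof.
split=> [bB U U0 _|bB U /nbhs_disk[W [dW W0 WU]]].
  exact/absorbs_swallows/bB.
have [r r0 WB] := swallows_absorbs dW (bB _ W0 dW); exists r => // t /WB tW.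
by move=> x /tW[w Ww <-]; exists w => //; exact: WU.
Qed.

Lemma bornologicalP E : bornological E <->
  forall A, disk A -> (forall B : set E, vN_bounded B -> swallows A B) ->
    nbhs (0 : E) A.
Proof.
split=> bE A dA AB; apply: bE => // B /AB; first exact: swallows_absorbs.
exact: absorbs_swallows.
Qed.

Lemma vN_bounded_subset E (B B' : set E) : B `<=` B' -> vN_bounded B' ->
  vN_bounded B.
Proof.
move=> BB bB U /bB[r r0 UB]; exists r => // t /UB; exact: subset_trans.
Qed.

Lemma vN_bounded_point E (x : E) : vN_bounded [set x].
Proof. by apply/vN_boundedP => U U0 _; exact: nbhs_swallows_point. Qed.

Lemma vN_bounded_image E F (g : linear_continuous_map E F) (B : set E) :
  vN_bounded B -> vN_bounded (g @` B).
Proof.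
move=> /vN_boundedP bB; apply/vN_boundedP => U U0 dU.
have [||c c0 BU] := bB (g @^-1` U).
- by apply: (lcm_continuous g 0); rewrite lcm0.
- exact: disk_preimage (lcm_linear g) dU.
- by exists c => // _ [x /BU /= + <-]; rewrite lcmZ.
Qed.

(** The preimage of an absolutely convex neighbourhood is absolutely convex and absorbs every
    bounded set, so bornologicity makes it a neighbourhood. Continuity out of such a space is thus a
    matter of bounded sets. *)
Lemma vN_bounded_continuous E F (g : E -> F) : bornological E -> linear g ->
  (forall B, vN_bounded B -> vN_bounded (g @` B)) -> continuous g.
Proof.
move=> /bornologicalP bE lg bg; apply: linear0_continuous => // U.
move=> /nbhs_disk[W [dW W0 WU]].
apply: (@filterS _ _ _ (g @^-1` W)); first by move=> x /WU.
apply: bE => [|B /bg/vN_boundedP/(_ _ W0 dW)[c c0 gB]].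
  exact: disk_preimage.
by exists c => // x Bx /=; rewrite (linear_funZ lg); apply: gB; exists x.
Qed.

End Boundedness.

(** * Locally convex topologies generated by prescribed bounded sets *)

Section BornologicalTopology.
Variables (K : numFieldType) (V : lmodType K).

(* V with the finest locally convex topology in which every member of D is
   bounded. *)
Definition bornspace (_ : set (set V)) : Type := V.

Variable D : set (set V).
Local Notation E := (bornspace D).

HB.instance Definition _ := GRing.Lmodule.on E.

(** Gauges become the basic neighbourhoods of 0. That they absorb points is required separately,
    since the members of [D] need not cover [V]. *)
Definition gauge (U : set V) : Prop :=
  [/\ disk U, forall x, swallows U [set x] & forall B, D B -> swallows U B].

Let gaugeI U U' : gauge U -> gauge U' -> gauge (U `&` U').
Proof.
move=> [dU pU bU] [dU' pU' bU']; split; first exact: diskI.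
  by move=> x; exact: swallowsI.
by move=> B DB; apply: swallowsI => //; [exact: bU|exact: bU'].
Qed.

Let gauge_dilate U c : 0 < c -> gauge U -> gauge [set x | U (c *: x)].
Proof.
move=> c0 [dU pU bU]; split; first exact: disk_dilate.
  by move=> x; exact: swallows_dilate.
by move=> B DB; apply: swallows_dilate => //; exact: bU.
Qed.

Let gaugeT : gauge setT.
Proof. by split=> // *; exists 1. Qed.

Let gauge0 U : gauge U -> U 0.
Proof. by move=> [dU /(_ 0)[c _ Uc] _]; apply: (disk0 dU (Uc 0 _)). Qed.

Let gauge_half U x y : gauge U -> U (2%:R *: x) -> U (2%:R *: y) -> U (x + y).
Proof.
move=> [dU _ _] Ux Uy.
have n2 : (2%:R : K) != 0 by rewrite pnatr_eq0.
rewrite -[x]scale1r -[y]scale1r -(mulVf n2) -!scalerA.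
by apply: dU => //; rewrite ger0_norm ?invr_ge0// [leRHS]splitr div1r.
Qed.

Let born_nbhs (x : E) : set_system E :=
  [set A | exists2 U, gauge U & forall y, U (y - x) -> A y].

HB.instance Definition _ := hasNbhs.Build E born_nbhs.

Let born_nbhsE (x : E) (A : set E) :
  nbhs x A <-> exists2 U, gauge U & forall y, U (y - x) -> A y.
Proof. by []. Qed.

Let born_filter (x : E) : ProperFilter (nbhs x).
Proof.
apply: Build_ProperFilter.
  by move=> [U gU /(_ x)]; rewrite subrr; apply; exact: gauge0.
split; first by exists setT.
- move=> A B [U gU UA] [U' gU' UB]; exists (U `&` U'); first exact: gaugeI.
  by move=> y [Uy U'y]; split; [exact: UA|exact: UB].
- by move=> A B AB [U gU UA]; exists U => // y /UA/AB.
Qed.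

Let born_singleton (x : E) (A : set E) : nbhs x A -> A x.
Proof. by move=> [U gU]; apply; rewrite subrr; exact: gauge0. Qed.

Let born_nbhs_nbhs (x : E) (A : set E) : nbhs x A -> nbhs x (nbhs^~ A).
Proof.
have n2 : 0 < 2%:R :> K by rewrite ltr0n.
move=> [U gU UA]; exists [set z | U (2%:R *: z)]; first exact: gauge_dilate.
move=> y /= Uy; exists [set z | U (2%:R *: z)]; first exact: gauge_dilate.
move=> z /= Uz; apply: UA; rewrite -(subrK y z) -addrA; exact: gauge_half.
Qed.

HB.instance Definition _ := Nbhs_isNbhsTopological.Build E
  born_filter born_singleton born_nbhs_nbhs.

Let born_add_continuous : continuous (fun x : E * E => x.1 + x.2).
Proof.
move=> [x y] A /= /born_nbhsE[U gU UA].
have n2 : 0 < 2%:R :> K by rewrite ltr0n.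
exists ([set x' | U (2%:R *: (x' - x))], [set y' | U (2%:R *: (y' - y))]).
  by split; apply/born_nbhsE; exists [set z | U (2%:R *: z)] => //;
    exact: gauge_dilate.
move=> [x' y'] [/= Ux Uy]; apply: UA; rewrite opprD addrACA.
exact: gauge_half.
Qed.

Let born_scale_continuous : continuous (fun z : K^o * E => z.1 *: z.2).
Proof.
move=> [k x] A /= /born_nbhsE[U gU UA].
have n2 : 0 < 2%:R :> K by rewrite ltr0n.
have [dU /(_ x)[c c0 /(_ x erefl) Ucx] _] := gU.
(* [M / 2] bounds [|l|] for [|k - l| < 1]. In [l y - k x = (l - k) x + l (y - x)] both terms then
   become multiples, by factors of modulus at most 1/2, of points of [U]. *)
pose M : K := 2%:R * (`|k| + 1).
have M0 : 0 < M by rewrite mulr_gt0// ltr_wpDl.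
exists ([set l | `|k - l| < c / 2%:R] `&` [set l | `|k - l| < 1],
  [set y | U (M *: (y - x))]).
  split=> /=; last first.
    by apply/born_nbhsE; exists [set z | U (M *: z)] => //; exact: gauge_dilate.
  by apply: filterI; apply/nbhs_normP; [exists (c / 2%:R)|exists 1] => //=;
    rewrite divr_gt0.
move=> [l y] [/= [kl1 kl2] Uy]; apply: UA.
have -> : l *: y - k *: x =
    ((l - k) / c) *: (c *: x) + (l / M) *: (M *: (y - x)).
  rewrite !scalerA !divfK ?lt0r_neq0// scalerBl scalerBr.
  by rewrite [RHS]addrC addrA subrK.
apply: dU => //; rewrite normf_div (gtr0_norm c0) normf_div (gtr0_norm M0).
apply: (@le_trans _ _ (2%:R^-1 + 2%:R^-1)); last first.
  by rewrite [leRHS]splitr div1r.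
apply: lerD.
  by rewrite ler_pdivrMr// distrC mulrC ltW.
rewrite ler_pdivrMr// /M mulrA mulVf ?lt0r_neq0// mul1r.
rewrite -[l](subrK k) (le_trans (ler_normD _ _))// addrC lerD2l distrC.
exact: ltW.
Qed.

Let born_locally_convex :
  exists2 B : set_system E, (forall b, b \in B -> convex_set b) & basis B.
Proof.
exists [set b | convex_set b /\ open b]; first by move=> b /set_mem[].
split; first by move=> b [].
move=> x A /= /born_nbhsE[U gU UA].
pose N : set E := [set y | U (y - x)].
have nN : nbhs x N by exists U.
exists (N°); last by move=> y /interior_subset/UA.
split; last exact: nN.
split; last exact: open_interior.
have key (y z v : V) (t : K) : 0 <= t -> 0 <= 1 - t ->
    U (y + v - x) -> U (z + v - x) -> U (t *: y + (1 - t) *: z + v - x).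
  have [dU _ _] := gU; move=> t0 t1 Uy Uz.
  have -> : t *: y + (1 - t) *: z + v - x =
      t *: (y + v - x) + (1 - t) *: (z + v - x).
    rewrite -!addrA !(scalerDr _ _ (v - x)) [RHS]addrACA -scalerDl.
    by rewrite [t + _]addrC subrK scale1r addrA.
  by apply: dU => //; rewrite !ger0_norm// addrC subrK.
(* The interior of the translated gauge is convex: if [y + V1] and [z + V2] lie in [N], then so does
   the translate of [V1] intersected with [V2] to any convex combination of [y] and [z]. *)
move=> y z t /set_mem[V1 gV1 V1N] /set_mem[V2 gV2 V2N]; apply/mem_set.
exists (V1 `&` V2); first exact: gaugeI.
move=> w [V1w V2w]; rewrite /N /= -[w](subrK (conv t y z)).
rewrite [_ + conv t y z]addrC.
apply: key; rewrite ?subr_ge0//.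
  by apply: V1N; rewrite addrC addKr.
by apply: V2N; rewrite addrC addKr.
Qed.

(* This factory provides only the uniform structure. *)
HB.instance Definition _ := PreTopologicalLmod_isTvs.Build K E
  born_add_continuous born_scale_continuous born_locally_convex.
HB.instance Definition _ :=
  PreTopologicalNmodule_isTopologicalNmodule.Build E born_add_continuous.
HB.instance Definition _ :=
  TopologicalNmodule_isTopologicalLmodule.Build K E born_scale_continuous.
HB.instance Definition _ := Uniform_isTvs.Build K E born_locally_convex.

Lemma nbhs0_bornspaceP (A : set E) :
  nbhs (0 : E) A <-> exists2 U, gauge U & U `<=` A.
Proof.
by split=> -[U gU UA]; exists U => // y; have := UA y; rewrite subr0.
Qed.

Lemma bornspace_bounded (B : set E) : D B -> vN_bounded B.
Proof.
move=> DB; apply/vN_boundedP => A /nbhs0_bornspaceP[U [_ _ /(_ _ DB)[c c0 UB]] UA] _.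
by exists c => // x /UB/UA.
Qed.

(** A disk absorbing all bounded sets absorbs points and members of [D], so it is itself a gauge. *)
Lemma bornological_bornspace : bornological (E : tvsType K).
Proof.
apply/bornologicalP => A dA bA; apply/nbhs0_bornspaceP; exists A => //.
split=> // [x|B DB]; apply: bA; first exact: vN_bounded_point.
exact: bornspace_bounded.
Qed.

(** One half of the universal property: maps out of [bornspace D] are tested on [D] alone. Maps into
    it from a bornological space are treated by [to_bornspace_continuous]. *)
Lemma bornspace_continuous (F : tvsType K) (g : E -> F) : linear g ->
  (forall B, D B -> vN_bounded (g @` B)) -> continuous g.
Proof.
move=> lg bg; apply: linear0_continuous => // U /nbhs_disk[W [dW W0 WU]].
have gZ := linear_funZ lg.
apply/nbhs0_bornspaceP; exists (g @^-1` W); last by move=> x /WU.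
split; first exact: disk_preimage.
  move=> x; have [c c0 Wc] := nbhs_swallows_point (g x) W0.
  by exists c => // _ ->; rewrite /= gZ; exact: Wc.
move=> B /bg/vN_boundedP/(_ _ W0 dW)[c c0 WB].
by exists c => // x Bx; rewrite /= gZ; apply: WB; exists x.
Qed.

End BornologicalTopology.

(** * The category of bornological spaces *)

Section BornologicalConstructions.
Variable K : numFieldType.

Lemma to_bornspace_continuous (E : tvsType K) (V : lmodType K)
    (D : set (set V)) (v : E -> bornspace D) : bornological E -> linear v ->
  (forall B, vN_bounded B -> D (v @` B)) -> continuous v.
Proof.
move=> bE lv Dv; apply: vN_bounded_continuous => // B /Dv.
exact: bornspace_bounded.
Qed.

Section Coimage.
Variables (E : tvsType K) (bE : bornological E) (Y : lmodType K) (a : E -> Y).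
Hypothesis (la : linear a) (sa : forall y, exists x, a x = y).

(** Quotients are formed along an arbitrary surjection [a], not only along the canonical projection,
    so that [eval2] can be used as a quotient map directly. *)
Definition image_bornology : set (set Y) :=
  [set B | exists2 A, vN_bounded A & B = a @` A].

Lemma coimage_map_continuous : continuous (a : E -> bornspace image_bornology).
Proof. by apply: to_bornspace_continuous => // B bB; exists B. Qed.

Definition coimage_map : linear_continuous_map E (bornspace image_bornology) :=
  @LinearContinuousMap K E (bornspace image_bornology) a la
    coimage_map_continuous.

Lemma coimage_descent (X : tvsType K) (u : linear_continuous_map E X) :
  (forall x, a x = 0 -> u x = 0) ->
  exists v : linear_continuous_map (bornspace image_bornology) X,
    forall x, v (coimage_map x) = u x.
Proof.
move=> au; pose v (y : bornspace image_bornology) : X := u (sval (cid (sa y))).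
have va x : v (a x) = u x.
  rewrite /v; case: cid => /= z az; apply/eqP.
  rewrite -subr_eq0 -lcmB; apply/eqP/au.
  by rewrite -scaleN1r addrC la az scaleN1r addNr.
have lv : linear v.
  move=> c y z; have [x <-] := sa y; have [x' <-] := sa z.
  by rewrite !va -lcm_linear -va la.
have cv : continuous v.
  apply: bornspace_continuous => // _ [A bA ->].
  rewrite image_comp (_ : v \o a = u); first exact: vN_bounded_image.
  exact/funext.
by exists (LinearContinuousMap lv cv).
Qed.

End Coimage.

Definition bor_of (V : lmodType K) (D : set (set V)) : BOR K :=
  exist _ (bornspace D : tvsType K) (@bornological_bornspace K V D).

Let FB (E : {E : tvsType K | bornological E}) : tvsType K := sval E.

(** The subspace topology need not be bornological, so the subspace gets the topology generated by
    the sets bounded in [E]. Lifts stay continuous because they start at a bornological space and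
    preserve bounded sets. *)
Lemma bor_has_sub (E : BOR K) (S : set (FB E)) : linear_subspace S ->
  exists (X : BOR K) (m : linear_continuous_map (FB X) (FB E)),
    strict_sub S m.
Proof.
move=> lS; pose D : set (set (submodule lS)) :=
  [set B | vN_bounded (submodule_val (lS := lS) @` B)].
have cm : continuous (submodule_val (lS := lS) : bornspace D -> FB E).
  by apply: bornspace_continuous => // B.
exists (bor_of D), (@LinearContinuousMap K (bornspace D) (FB E) _
  (submodule_val_linear (lS := lS)) cm); split.
- exact: submodule_val_inj.
- exact: submodule_valP.
- exact: submodule_val_surj.
move=> X u Su; pose v x : bornspace D := exist _ (u x) (Su x) : submodule lS.
have lv : linear v.
  by move=> a x y; apply: submodule_val_inj; exact: lcm_linear.
suff cv : continuous v by exists (LinearContinuousMap lv cv).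
apply: to_bornspace_continuous => // [|B bB]; first exact: svalP.
rewrite /D /= image_comp; exact: vN_bounded_image.
Qed.

Lemma bor_coimage_strict_quo (E : BOR K) (Y : lmodType K) (a : FB E -> Y)
    (la : linear a) : (forall y, exists x, a x = y) ->
  @strict_quo K _ FB E [set x | a x = 0] (bor_of (image_bornology a))
    (coimage_map (svalP E) la).
Proof.
by move=> sa; split=> // k u; exact: coimage_descent.
Qed.

Lemma bor_has_quo (E : BOR K) (S : set (FB E)) : linear_subspace S ->
  exists (X : BOR K) (q : linear_continuous_map (FB E) (FB X)),
    strict_quo S q.
Proof.
move=> lS; have lq := quotient_pi_linear lS.
exists (bor_of (image_bornology (quotient_pi lS))), (coimage_map (svalP E) lq).
have kerE : [set x | quotient_pi lS x = 0] = S.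
  by apply/funext => x; exact/propext/quotient_pi_eq0.
have := bor_coimage_strict_quo lq (@quotient_pi_surj _ _ _ lS).
by rewrite kerE.
Qed.

Lemma bor_has_biproduct (E F : BOR K) : exists (X : BOR K)
    (m1 : linear_continuous_map (FB E) (FB X))
    (m2 : linear_continuous_map (FB F) (FB X))
    (p1 : linear_continuous_map (FB X) (FB E))
    (p2 : linear_continuous_map (FB X) (FB F)),
  [/\ forall x, p1 (m1 x) = x, forall y, p2 (m2 y) = y &
      forall z, m1 (p1 z) + m2 (p2 z) = z].
Proof.
pose V : lmodType K := (FB E * FB F)%type.
pose D : set (set V) :=
  [set B | vN_bounded (fst @` B) /\ vN_bounded (snd @` B)].
pose m1 (x : FB E) : bornspace D := (x, 0) : V.
pose m2 (y : FB F) : bornspace D := (0, y) : V.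
have lp1 : linear (fst : bornspace D -> FB E) by [].
have lp2 : linear (snd : bornspace D -> FB F) by [].
have lm1 : linear m1 by move=> a x y; congr pair; rewrite /= scaler0 addr0.
have lm2 : linear m2 by move=> a x y; congr pair; rewrite /= scaler0 addr0.
have cp1 : continuous (fst : bornspace D -> FB E).
  by apply: bornspace_continuous => // B [].
have cp2 : continuous (snd : bornspace D -> FB F).
  by apply: bornspace_continuous => // B [].
have cm1 : continuous m1.
  apply: to_bornspace_continuous => // [|B bB]; first exact: svalP.
  split; rewrite image_comp.
    by apply: vN_bounded_subset bB => _ [x Bx <-].
  by apply: vN_bounded_subset (@vN_bounded_point _ _ 0) => _ [x Bx <-].
have cm2 : continuous m2.
  apply: to_bornspace_continuous => // [|B bB]; first exact: svalP.
  split; rewrite image_comp.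
    by apply: vN_bounded_subset (@vN_bounded_point _ _ 0) => _ [x Bx <-].
  by apply: vN_bounded_subset bB => _ [x Bx <-].
exists (bor_of D), (LinearContinuousMap lm1 cm1), (LinearContinuousMap lm2 cm2),
  (@LinearContinuousMap K (bornspace D) (FB E) _ lp1 cp1),
  (@LinearContinuousMap K (bornspace D) (FB F) _ lp2 cp2).
split=> //= -[x y]; congr pair; [exact: addr0|exact: add0r].
Qed.

Lemma bor_has_zero : exists Z : BOR K, zero_object Z.
Proof.
pose V : lmodType K := 'rV[K]_0; exists (bor_of (@set0 (set V))).
by apply/(@full_zero_object K _ FB) => x; exact: (@thinmx0 K 1 x).
Qed.

(** Non-Hausdorff quotients are allowed, so every subspace counts as closed and [closed_sub] is
    trivially true. *)
Lemma bor_semi_abelian : semi_abelian (BOR K).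
Proof.
apply: (@full_semi_abelian K _ FB bor_has_zero (fun _ _ => True)) => //.
- move=> E S lS _; have [X [m mS]] := bor_has_sub lS.
  by exists X, m.
- by move=> E S lS _; exact: bor_has_quo.
- exact: bor_has_biproduct.
Qed.

End BornologicalConstructions.

(** * Cokernels of bornological spaces under pullback *)

Section BivariatePolynomials.
Variable K : numFieldType.

(* {poly {poly K}} is a module over {poly K}; here it is one over K. *)
Definition bipoly : Type := {poly {poly K}}.

HB.instance Definition _ := GRing.Zmodule.on bipoly.

Let scale (a : K) (w : bipoly) : bipoly := a%:P *: (w : {poly {poly K}}).

Let scaleA a b (w : bipoly) : scale a (scale b w) = scale (a * b) w.
Proof. by rewrite /scale scalerA polyCM. Qed.
Let scale1 : left_id 1 scale.
Proof. by move=> w; exact: scale1r. Qed.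
Let scaleDr : right_distributive scale +%R.
Proof. by move=> a v w; exact: scalerDr. Qed.
Let scaleDl (w : bipoly) : {morph scale^~ w : a b / a + b}.
Proof. by move=> a b; rewrite /scale polyCD scalerDl. Qed.

HB.instance Definition _ :=
  GRing.Zmodule_isLmodule.Build K bipoly scaleA scale1 scaleDr scaleDl.

(** The outer variable is Y and the inner one X: [bicoef w i j] is the coefficient of [X^j Y^i], and
    for nonzero [w] [bisize] is the Y-degree plus one. *)
Definition bisize (w : bipoly) : nat := size (w : {poly {poly K}}).
Definition bicol (w : bipoly) (i : nat) : {poly K} := (w : {poly {poly K}})`_i.
Definition bicoef (w : bipoly) (i j : nat) : K := (bicol w i)`_j.

Lemma bicoef_lin (a b : K) (v w : bipoly) i j :
  bicoef (a *: v + b *: w) i j = a * bicoef v i j + b * bicoef w i j.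
Proof. by rewrite /bicoef /bicol coefD !coefZ coefD !coefCM. Qed.

Lemma bicoefZ (a : K) (w : bipoly) i j : bicoef (a *: w) i j = a * bicoef w i j.
Proof. by rewrite /bicoef /bicol coefZ coefCM. Qed.

Definition eval2 (w : bipoly) : {poly K} := map_poly (horner_eval 2%:R) w.

Lemma eval2_linear : linear eval2.
Proof.
move=> a v w; rewrite /eval2 rmorphD /=; congr (_ + _).
by rewrite map_polyZ /= /horner_eval hornerC.
Qed.

Lemma coef_eval2 w i : (eval2 w)`_i = (bicol w i).[2%:R].
Proof. by rewrite coef_map. Qed.

Lemma coef_bounded (p : {poly K}) : exists M, 0 <= M /\ forall i, `|p`_i| <= M.
Proof.
exists (\sum_(i < size p) `|p`_i|); split; first exact: sumr_ge0.
move=> i; have [ip|ip] := ltnP i (size p); last first.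
  by rewrite nth_default// normr0 sumr_ge0.
by rewrite (bigD1 (Ordinal ip))//= lerDl sumr_ge0.
Qed.

Lemma bicoef_bounded (w : bipoly) :
  exists M, 0 <= M /\ forall i j, `|bicoef w i j| <= M.
Proof.
pose M i := sval (cid (coef_bounded (bicol w i))).
have M0 i : 0 <= M i by rewrite /M; case: cid => m [].
have wM i j : `|bicoef w i j| <= M i by rewrite /M; case: cid => m [_ mM] /=; exact: mM.
exists (\sum_(i < bisize w) M i); split; first exact: sumr_ge0.
move=> i j; have [iw|iw] := ltnP i (bisize w); last first.
  by rewrite /bicoef /bicol (nth_default _ iw) coef0 normr0 sumr_ge0.
by rewrite (le_trans (wM _ _))// (bigD1 (Ordinal iw))//= lerDl sumr_ge0.
Qed.

Lemma positive_lower_bound (e : nat -> K) n : (forall i, 0 < e i) ->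
  exists2 c, 0 < c & forall i, (i < n)%N -> c <= e i.
Proof.
move=> e0; elim: n => [|n [c c0 ce]]; first by exists 1.
have s0 : 0 < c + e n by rewrite addr_gt0.
have c_le : c * e n / (c + e n) <= c.
  by rewrite ler_pdivrMr// ler_pM2l// lerDr ltW.
exists (c * e n / (c + e n)); first by rewrite divr_gt0 ?mulr_gt0.
move=> i; rewrite ltnS leq_eqVlt => /orP[/eqP ->|/ce]; last exact: le_trans.
by rewrite ler_pdivrMr// mulrC ler_pM2l// lerDl ltW.
Qed.

End BivariatePolynomials.

Section BornologicalPullback.
Variable K : numFieldType.
Hypothesis archi : forall x : K, 0 < x -> exists n, x < n%:R.

Lemma archi_pow2 (x : K) : 0 < x -> exists n, x < 2%:R ^+ n.
Proof.
move=> /archi[n xn]; exists n; rewrite (lt_trans xn)// -natrX ltr_nat.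
exact: ltn_expl.
Qed.

Let W : lmodType K := bipoly K.
Let Y : lmodType K := {poly K}.

(** The X-degree is left unrestricted; this makes evaluation at X = 2 unbounded on every [box n]
    with [n > 0]. *)
Let box n : set W := [set w |
  (bisize w <= n)%N /\ forall i j, `|bicoef w i j| <= 1].

Let ballY : set Y := [set y : {poly K} | forall i, `|y`_i| <= 1].

Let ballK : set (K^o : lmodType K) := [set x : K^o | `|x| <= 1].

Let E : BOR K := bor_of (range box).
Let B : BOR K := bor_of [set ballY].
Let T : BOR K := bor_of [set ballK].

Let Etvs : tvsType K := sval E.
Let Btvs : tvsType K := sval B.
Let Ttvs : tvsType K := sval T.

(** An element of [box n] meets only the weights [e 0, ..., e (n - 1)], which have a positive lower
    bound. Hence the weights may decay arbitrarily fast. *)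
Let weighted_gauge (e : nat -> K) : (forall i, 0 < e i) ->
  gauge (range box) [set w | forall i j, `|bicoef w i j| <= e i].
Proof.
move=> e0; have small n M : 0 <= M -> exists2 c, 0 < c &
    forall w : W, (bisize w <= n)%N ->
    (forall i j, `|bicoef w i j| <= M) ->
    forall i j, `|bicoef (c *: w) i j| <= e i.
  move=> M0; have [c c0 ce] := positive_lower_bound n e0.
  have M1 : 0 < M + 1 by rewrite ltr_wpDl.
  exists (c / (M + 1)); first by rewrite divr_gt0.
  move=> w wn wM i j; rewrite bicoefZ.
  have [ni|ni] := ltnP i n; last first.
    rewrite /bicoef /bicol (nth_default _ (leq_trans wn ni)) coef0 mulr0 normr0.
    exact: ltW.
  rewrite normrM (gtr0_norm (divr_gt0 c0 M1)) (le_trans _ (ce i ni))//.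
  rewrite mulrAC ler_pdivrMr// ler_pM2l// (le_trans (wM i j))//.
  by rewrite lerDl.
split.
- move=> v w a b /= vU wU ab i j; rewrite bicoef_lin.
  rewrite (le_trans (ler_normD _ _))// !normrM.
  rewrite -[leRHS]mul1r (le_trans (lerD (ler_wpM2l _ (vU i j))
    (ler_wpM2l _ (wU i j))))//.
  by rewrite -mulrDl ler_wpM2r// ltW.
- move=> w; have [M [M0 wM]] := bicoef_bounded w.
  have [c c0 cU] := small (bisize w) M M0.
  by exists c => // _ ->; exact: cU.
- move=> _ [n _ <-]; have [c c0 cU] := small n 1 ler01.
  by exists c => // w [wn w1]; exact: cU.
Qed.

(** If the Y-degrees in [S] were unbounded, weights adapted to [S] would give a neighbourhood of 0
    that does not absorb [S]. *)
Let bounded_size (S : set Etvs) : vN_bounded S ->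
  exists n, forall w, S w -> (bisize w <= n)%N.
Proof.
move=> /vN_boundedP bS; apply: contrapT => nS.
have big n : exists2 w : W, S w & (n < bisize w)%N.
  apply: contrapT => nw; apply: nS; exists n => w Sw.
  by rewrite leqNgt; apply/negP => wn; apply: nw; exists w.
pose P i (w : W) := S w /\ bicol w i != 0.
(* Some member of [S] has a coefficient at [Y^i] whose leading X-coefficient is [i + 1] times the
   weight. Where no member of [S] involves [Y^i], the weight 1 is a default. *)
pose e i : K := if pselect (exists w, P i w) is left h then
  `|lead_coef (bicol (sval (cid h)) i)| / i.+1%:R else 1.
have e0 i : 0 < e i.
  rewrite /e; case: pselect => // h; case: cid => /= w [_ wi].
  by rewrite divr_gt0 ?ltr0n// normr_gt0 lead_coef_eq0.
pose U : set W := [set w | forall i j, `|bicoef w i j| <= e i].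
have gU := weighted_gauge e0; have [dU _ _] := gU.
have nU : nbhs (0 : Etvs) U by apply/nbhs0_bornspaceP; exists U.
have [c c0 cU] := bS U nU dU.
have [n cn] : exists n, c^-1 < n%:R by apply: archi; rewrite invr_gt0.
(* With [i] the Y-degree of [w], the member [v] chosen for [e i] gives [c (i + 1) <= 1], whereas
   [i + 1 > n > 1 / c]. The polynomial [v] may differ from [w]. *)
have [w Sw nw] := big n.
pose i := (bisize w).-1.
have [v [Sv vi ei]] : exists v : W, [/\ S v, bicol v i != 0 &
    e i = `|lead_coef (bicol v i)| / i.+1%:R].
  rewrite /e; case: pselect => [h|[]].
    by case: cid => /= v [Sv vi]; exists v.
  exists w; split=> //; rewrite -[bicol _ _]/(lead_coef (w : {poly {poly K}})).
  by rewrite lead_coef_eq0 -size_poly_gt0 (leq_ltn_trans _ nw).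
have := cU v Sv i (size (bicol v i)).-1.
rewrite bicoefZ ei normrM (gtr0_norm c0) mulrC ler_pM2l; last first.
  by rewrite normr_gt0 lead_coef_eq0.
rewrite -[leRHS]mul1r ler_pdivlMr ?ltr0n// => ci1.
have : i.+1%:R < n%:R :> K.
  apply: le_lt_trans cn; rewrite -[i.+1%:R](mulKf (lt0r_neq0 c0)).
  by rewrite ler_piMr ?invr_ge0 ?(ltW c0).
by rewrite ltr_nat /i (prednK (leq_ltn_trans (leq0n n) nw)) ltnNge (ltnW nw).
Qed.

Let gauge_ballY : gauge [set ballY] ballY.
Proof.
split.
- move=> x y a b /= xU yU ab i; rewrite coefD !coefZ.
  rewrite (le_trans (ler_normD _ _))// !normrM (le_trans _ ab)// lerD//.
    by rewrite ler_piMr.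
  by rewrite ler_piMr.
- move=> x; have [M [M0 xM]] := coef_bounded x.
  have M1 : 0 < M + 1 by rewrite ltr_wpDl.
  exists (M + 1)^-1; first by rewrite invr_gt0.
  move=> _ -> i; rewrite coefZ normrM gtr0_norm ?invr_gt0//.
  by rewrite mulrC ler_pdivrMr// mul1r (le_trans (xM i))// lerDl.
- by move=> _ ->; exists 1 => // y; rewrite scale1r.
Qed.

Let gauge_ballK : gauge [set ballK] ballK.
Proof.
split.
- move=> x y a b /= xU yU ab; rewrite /ballK /=.
  rewrite (le_trans (ler_normD _ _))// !normrM (le_trans _ ab)// lerD//.
    by rewrite ler_piMr.
  by rewrite ler_piMr.
- move=> x; have M1 : 0 < `|x| + 1 by rewrite ltr_wpDl.
  exists (`|x| + 1)^-1; first by rewrite invr_gt0.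
  move=> _ ->; rewrite /ballK /= normrM gtr0_norm ?invr_gt0//.
  by rewrite mulrC ler_pdivrMr// mul1r lerDl.
- by move=> _ ->; exists 1 => // y; rewrite scale1r.
Qed.

Let bounded_coef (S : set Btvs) : vN_bounded S ->
  exists2 M, 0 < M & forall y : {poly K}, S y -> forall i, `|y`_i| <= M.
Proof.
move=> /vN_boundedP bS; have [dB _ _] := gauge_ballY.
have nB : nbhs (0 : Btvs) ballY by apply/nbhs0_bornspaceP; exists ballY.
have [c c0 cS] := bS _ nB dB; exists c^-1; first by rewrite invr_gt0.
move=> y /cS cy i; have := cy i; rewrite coefZ normrM (gtr0_norm c0).
by rewrite -[c^-1]mul1r ler_pdivlMr// mulrC.
Qed.

Let bounded_norm (S : set Ttvs) :
  vN_bounded S <-> exists2 M : K, 0 < M & forall x : K^o, S x -> `|x| <= M.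
Proof.
have [dK _ _] := gauge_ballK; split=> [/vN_boundedP bS|[M M0 SM]].
  have nK : nbhs (0 : Ttvs) ballK by apply/nbhs0_bornspaceP; exists ballK.
  have [c c0 cS] := bS _ nK dK; exists c^-1; first by rewrite invr_gt0.
  move=> x /cS; rewrite /ballK /= normrM (gtr0_norm c0).
  by rewrite -[c^-1]mul1r ler_pdivlMr// mulrC.
apply/vN_boundedP => U /nbhs0_bornspaceP[V [_ _ /(_ _ erefl)[c c0 cV]] VU] _.
exists (c / M); first by rewrite divr_gt0.
move=> x /SM xM; apply: VU; rewrite -scalerA; apply: cV.
by rewrite /ballK /= normrM normfV (gtr0_norm M0) mulrC ler_pdivrMr// mul1r.
Qed.

Let eval2_surj (y : Y) : exists w : W, eval2 w = y.
Proof.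
exists (map_poly polyC (y : {poly K})); apply/polyP => i.
by rewrite coef_eval2 /bicol coef_map /= hornerC.
Qed.

(* Evaluation at 2 is unbounded on the unit ball of {poly K}, so it maps box n
   onto all polynomials of size at most n. *)
Let eval2_box n (y : {poly K}) : (size y <= n)%N ->
  exists2 w : W, box n w & eval2 w = y.
Proof.
move=> yn; have [M [M0 yM]] := coef_bounded y.
have [N MN] : exists N, M + 1 < 2%:R ^+ N by apply: archi_pow2; rewrite ltr_wpDl.
have N0 : 0 < 2%:R ^+ N :> K by rewrite exprn_gt0 ?ltr0n.
(* The coefficient of [Y^i] is a small multiple of [X^N], whose value at 2 restores the factor
   [2^N]. *)
pose w : {poly {poly K}} := \poly_(i < n) ((y`_i / 2%:R ^+ N) *: 'X^N).
exists w; first split; first exact: size_poly.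
  move=> i j; rewrite /bicoef /bicol coef_poly; case: ifP => _; last first.
    by rewrite coef0 normr0.
  rewrite coefZ coefXn normrM; case: (_ == _); last by rewrite normr0 mulr0.
  rewrite normr1 mulr1 normf_div (gtr0_norm N0) ler_pdivrMr// mul1r.
  rewrite (le_trans (yM i))// (le_trans _ (ltW MN))//.
  by rewrite lerDl.
apply/polyP => i; rewrite coef_eval2 /bicol coef_poly; case: ltnP => ni.
  by rewrite hornerZ hornerXn divfK ?lt0r_neq0.
by rewrite horner0 nth_default// (leq_trans yn).
Qed.

Let D : BOR K :=
  bor_of (image_bornology (eval2 (K := K) : Etvs -> Y)).
Let Dtvs : tvsType K := sval D.

(** A neighbourhood absorbs the image of [box n] for [n = size y], and this image contains all
    scalar multiples of [y]. *)
Let indiscrete (U : set Dtvs) (y : Y) : nbhs (0 : Dtvs) U -> U y.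
Proof.
move=> /nbhs0_bornspaceP[V [_ _ bV] VU]; apply: VU.
have bn : vN_bounded (box (size (y : {poly K})) : set Etvs).
  by apply: bornspace_bounded; exists (size (y : {poly K})).
have [|c c0 cV] := bV (@eval2 K @` box (size (y : {poly K}))).
  by exists (box (size (y : {poly K}))).
rewrite -[y]scale1r -(divff (lt0r_neq0 c0)) -scalerA; apply: cV.
have [|w nw ew] := @eval2_box (size (y : {poly K})) (c^-1 *: (y : {poly K})).
  by rewrite size_scale// invr_eq0 lt0r_neq0.
by exists w.
Qed.

Let P : BOR K := bor_of [set S : set W |
  vN_bounded (S : set Etvs) /\ vN_bounded (eval2 (K := K) @` S : set Btvs)].
Let Ptvs : tvsType K := sval P.

Let lid (V : lmodType K) : linear (@id V).
Proof. by []. Qed.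

Let cb : continuous (id : Ptvs -> Etvs).
Proof.
by apply: bornspace_continuous => // S [bS _]; rewrite image_id.
Qed.

Let b : linear_continuous_map Ptvs Etvs :=
  @LinearContinuousMap K Ptvs Etvs id (@lid W) cb.

Let ca : continuous (eval2 (K := K) : Ptvs -> Btvs).
Proof. by apply: bornspace_continuous => [|S []//]; exact: eval2_linear. Qed.

Let a : linear_continuous_map Ptvs Btvs :=
  @LinearContinuousMap K Ptvs Btvs _ (@eval2_linear K) ca.

Let cc : continuous (id : Btvs -> Dtvs).
Proof.
apply: bornspace_continuous => // S _; apply/vN_boundedP => U U0 _.
by exists 1 => // y _; exact: indiscrete.
Qed.

Let c : linear_continuous_map Btvs Dtvs :=
  @LinearContinuousMap K Btvs Dtvs id (@lid Y) cc.

Let d : linear_continuous_map Etvs Dtvs :=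
  coimage_map (svalP E) (@eval2_linear K : linear (_ : Etvs -> Y)).

Let square : pullback_square (C := BOR K) (A := P) (B := B) (E := E) (D := D)
  a b c d.
Proof.
split; first exact: lcm_ext.
move=> X u0 v0 uv.
pose u : linear_continuous_map (sval X) Btvs := u0.
pose v : linear_continuous_map (sval X) Etvs := v0.
have uE x : u x = eval2 (v x).
  exact: (congr1 (fun h : linear_continuous_map (sval X) Dtvs => h x) uv).
(* The pullback [P] has the underlying module of [E], so the mediating map is [v] itself; only its
   continuity is at stake. *)
have cw : continuous (v : sval X -> Ptvs).
  apply: to_bornspace_continuous; [exact: svalP|exact: (lcm_linear v)|].
  move=> S bS; split; first exact: (vN_bounded_image v).
  rewrite image_comp (_ : _ \o _ = u); first exact: (vN_bounded_image u).
  by apply/funext => x; rewrite uE.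
exists (@LinearContinuousMap K (sval X) Ptvs _ (lcm_linear v) cw).
split; first by split; apply: lcm_ext => x //=; rewrite uE.
move=> w [_ wv]; apply: lcm_ext => x.
exact: (congr1 (fun h : linear_continuous_map (sval X) Etvs => h x) (esym wv)).
Qed.

Let d_cokernel : is_cokernel (C := BOR K) (B := E) (D := D) d.
Proof.
have dS := bor_coimage_strict_quo (E := E) (@eval2_linear K) eval2_surj.
have [X [m mS]] := bor_has_sub (E := E)
  (linear_subspace_ker (d : linear_continuous_map Etvs Dtvs)).
apply: strict_quo_is_cokernel dS => //; first exact: bor_has_zero.
exact: mS.
Qed.

Let ev : Ptvs -> Ttvs := fun w => (eval2 (w : bipoly K)).[2%:R].

Let lev : linear ev.
Proof. by move=> k v w; rewrite /ev eval2_linear hornerD hornerZ. Qed.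

Let cev : continuous ev.
Proof.
apply: bornspace_continuous => // S [/bounded_size[n Sn] /bounded_coef[M M0 SM]].
(* Degree below [n] and coefficients bounded by [M] bound the value at 2. The summand 1 keeps the
   bound positive when [n = 0]. *)
apply/bounded_norm; exists (\sum_(i < n) M * 2%:R ^+ i + 1).
  rewrite ltr_wpDl// sumr_ge0// => i _; rewrite mulr_ge0 ?(ltW M0)//.
move=> _ [w Sw <-]; rewrite (@le_trans _ _ (\sum_(i < n) M * 2%:R ^+ i))//; last first.
  by rewrite lerDl.
have sn : (size (eval2 w) <= n)%N by rewrite (leq_trans (size_poly _ _))// Sn.
rewrite /ev (horner_coef_wide _ sn) (le_trans (ler_norm_sum _ _ _))//.
apply: ler_sum => i _; rewrite normrM normrX (ger0_norm (ler0n K 2)).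
by rewrite ler_wpM2r ?exprn_ge0//; apply: SM; exists w.
Qed.

Let evm : linear_continuous_map Ptvs Ttvs := LinearContinuousMap lev cev.

(** The continuous functional [ev] vanishes wherever [a] does, so a cokernel [a] would let it
    descend to a continuous functional [y |-> y(2)] on [B]. The monomials of degree [n] lie in
    [ballY] and take the value [2^n]. *)
Let a_not_cokernel : ~ is_cokernel (C := BOR K) (B := P) (D := B) a.
Proof.
move=> [Z [f [af uni]]].
have af0 := (full_zero_morphism (bor_has_zero K) _).1 af.
have [|u [ua _]] := uni T evm.
  apply/(full_zero_morphism (bor_has_zero K)) => x.
  have := af0 x; rewrite /= /ev => ->; exact: horner0.
have uE (y : {poly K}) : (u : linear_continuous_map Btvs Ttvs) y = y.[2%:R].
  have [w <-] := eval2_surj y.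
  exact: (congr1 (fun h : linear_continuous_map Ptvs Ttvs => h w) ua).
have bB : vN_bounded (ballY : set Btvs) by apply: bornspace_bounded.
have /bounded_norm[M M0 uM] :=
  vN_bounded_image (u : linear_continuous_map Btvs Ttvs) bB.
have [n Mn] := archi_pow2 M0.
have /uM : [set (u : linear_continuous_map Btvs Ttvs) y | y in ballY]
    (2%:R ^+ n : K^o).
  exists ('X^n : {poly K}); last by rewrite uE hornerXn.
  by move=> i; rewrite coefXn; case: (_ == _); rewrite ?normr1 ?normr0.
by rewrite ger0_norm ?exprn_ge0// => /(lt_le_trans Mn); rewrite ltxx.
Qed.

Lemma bor_cokernel_not_pullback_stable :
  ~ stable_under_pullback (C := BOR K) (@is_cokernel _).
Proof. by move=> st; exact: a_not_cokernel (st _ _ _ _ _ _ _ _ square d_cokernel). Qed.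

End BornologicalPullback.

(** * Banach spaces *)

Section GeometricRates.
Variable K : numFieldType.

(* Over the partially ordered fields considered here, these two properties
   replace the Archimedean axiom and the existence of infima of R. *)
Definition has_large_naturals : Prop :=
  forall x : K, 0 < x -> exists n, x < n%:R.
Definition has_infima : Prop := forall A : set K, A !=set0 ->
  (forall x, A x -> 0 <= x) -> exists m, [/\ 0 <= m, forall x, A x -> m <= x &
    forall e, 0 < e -> exists2 x, A x & x < m + e].

(** Completeness is expressed by sequences with an explicit geometric rate, so that estimates are
    plain inequalities in [K]. *)
Definition geometric_cauchy (V : zmodType) (N : V -> K) (x : nat -> V) (C : K) :=
  forall n, N (x n.+1 - x n) <= C / 2%:R ^+ n.

Definition geometric_cvg (V : zmodType) (N : V -> K) (x : nat -> V) (C : K)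
    (l : V) := forall n, N (l - x n) <= C / 2%:R ^+ n.

Definition geometrically_complete (V : zmodType) (N : V -> K) : Prop :=
  forall x C, geometric_cauchy N x C -> exists l C', geometric_cvg N x C' l.

Lemma pow2_gt0 n : 0 < 2%:R ^+ n :> K.
Proof. by rewrite exprn_gt0 ?ltr0n. Qed.

Lemma invr_pow2_le m n : (m <= n)%N ->
  (2%:R ^+ n)^-1 <= (2%:R ^+ m)^-1 :> K.
Proof.
by move=> mn; rewrite lef_pV2 ?posrE ?pow2_gt0//; apply: ler_weXn2l; rewrite ?ler1n.
Qed.

Hypothesis archi : has_large_naturals.

Lemma geometric_small (C e : K) : 0 <= C -> 0 < e ->
  exists n, C / 2%:R ^+ n < e.
Proof.
move=> C0 e0; have Ce : 0 < (C + 1) / e by rewrite divr_gt0// ltr_wpDl.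
have [n nC] := archi_pow2 archi Ce; exists n.
rewrite ltr_pdivrMr ?pow2_gt0//; move: nC; rewrite ltr_pdivrMr// mulrC.
by apply: lt_trans; rewrite ltrDl.
Qed.

(** This replaces passing to the limit in inequalities. Nonnegativity makes [x] and [y] comparable
    although [K] is only partially ordered. *)
Lemma le_geometric (x y C : K) : 0 <= x -> 0 <= y ->
  (forall n, x <= y + C / 2%:R ^+ n) -> x <= y.
Proof.
move=> x0 y0 xy.
have [//|yx] := real_leP (ger0_real x0) (ger0_real y0).
have C0 : 0 <= C.
  have := le_trans (ltW yx) (xy 0%N); rewrite expr0 divr1.
  by rewrite lerDl.
have [|n nC] := @geometric_small C (x - y) C0; first by rewrite subr_gt0.
by have := lt_le_trans (lt_le_trans (_ : y + C / 2%:R ^+ n < x) (xy n))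
  (lexx _); rewrite -ltrBrDl ltxx => /(_ nC).
Qed.

Lemma eq0_geometric (x C : K) : 0 <= x -> (forall n, x <= C / 2%:R ^+ n) ->
  x = 0.
Proof.
move=> x0 xC; apply/eqP; rewrite eq_le x0 andbT; apply: (@le_geometric _ _ C) => //.
by move=> n; rewrite add0r.
Qed.

(** The subtracted term closes the induction: passing from [k] to [k + 1] raises the bound by
    exactly [C / 2^(n + k)]. *)
Lemma geometric_tail (V : zmodType) (N : V -> K) (x : nat -> V) (C : K) n k :
  (forall u v, N (u + v) <= N u + N v) -> N 0 = 0 -> geometric_cauchy N x C ->
  N (x (n + k)%N - x n) <= 2%:R * C / 2%:R ^+ n - 2%:R * C / 2%:R ^+ (n + k).
Proof.
move=> ND N0 xC; elim: k => [|k IHk]; first by rewrite addn0 !subrr N0.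
rewrite addnS -(subrKA (x (n + k)%N)) addrC.
apply: le_trans (ND _ _) _; apply: le_trans (lerD IHk (xC _)) _.
rewrite -addrA lerD2l; set t := C / _.
have -> : 2%:R * C / 2%:R ^+ (n + k) = t + t by rewrite /t; ring.
have -> : 2%:R * C / 2%:R ^+ (n + k).+1 = t.
  by rewrite /t exprS; field; rewrite lt0r_neq0 ?pow2_gt0.
by rewrite opprD subrK.
Qed.

(** The rate of the limit depends on [C] alone and not on [C']. This gives uniformity when limits
    are taken coordinate by coordinate. *)
Lemma geometric_limit_rate (V : zmodType) (N : V -> K) (x : nat -> V)
    (C C' : K) l : (forall u v, N (u + v) <= N u + N v) -> N 0 = 0 ->
  (forall u, 0 <= N u) -> geometric_cauchy N x C -> geometric_cvg N x C' l ->
  geometric_cvg N x (2%:R * C) l.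
Proof.
move=> ND N0 Nge0 xC xl n.
have C0 : 0 <= C by have := le_trans (Nge0 _) (xC 0%N); rewrite expr0 divr1.
have C'0 : 0 <= C' by have := le_trans (Nge0 _) (xl 0%N); rewrite expr0 divr1.
apply: (@le_geometric _ _ C') => //.
  by rewrite divr_ge0 ?mulr_ge0 ?ler0n// ltW// pow2_gt0.
move=> k; rewrite -(subrKA (x (n + k)%N)) addrC [leRHS]addrC addrC.
apply: le_trans (ND _ _) _; apply: lerD.
  apply: le_trans (xl _) _; by rewrite ler_wpM2l// invr_pow2_le// leq_addl.
apply: le_trans (geometric_tail _ _ ND N0 xC) _.
by rewrite lerBlDr lerDl divr_ge0 ?mulr_ge0 ?ler0n// ltW// pow2_gt0.
Qed.

End GeometricRates.

(** * Banach spaces built from a module with a geometrically complete norm *)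

Section BanachBuilder.
Variable K : numFieldType.

Record banach_norm (V : lmodType K) := BanachNorm {
  bnorm :> V -> K;
  bnormD : forall x y, bnorm (x + y) <= bnorm x + bnorm y;
  bnormZ : forall a x, bnorm (a *: x) = `|a| * bnorm x;
  bnorm0_eq0 : forall x, bnorm x = 0 -> x = 0;
  bnorm_complete : geometrically_complete bnorm
}.

(** The Archimedean property is an argument of the alias because the completeness instance depends
    on it. *)
Definition banach_space (_ : has_large_naturals K) (V : lmodType K)
  (_ : banach_norm V) : Type := V.

Variables (archi : has_large_naturals K) (V : lmodType K) (N : banach_norm V).
Local Notation E := (banach_space archi N).

HB.instance Definition _ := GRing.Lmodule.on E.
HB.instance Definition _ := Lmodule_isNormed.Build K E
  (@bnormD V N) (@bnormZ V N) (@bnorm0_eq0 V N).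

(** Centres of balls of radius [2^-n] belonging to the filter form a geometric Cauchy sequence with
    constant 2, whose limit is a limit of the filter. *)
Let banach_cauchy_cvg (F : set_system E) : ProperFilter F -> cauchy F -> cvg F.
Proof.
move=> FF /cauchyP cF.
have ball_ex n : exists x : E, F (ball x (2%:R ^+ n)^-1).
  by apply: cF; rewrite invr_gt0 pow2_gt0.
pose x n := sval (cid (ball_ex n)).
have xF n : F (ball (x n) (2%:R ^+ n)^-1) by rewrite /x; case: cid.
have near_x n m : `|x n - x m| <= (2%:R ^+ n)^-1 + (2%:R ^+ m)^-1.
  have [z [xnz xmz]] := filter_ex (filterI (xF n) (xF m)).
  move: xnz xmz; rewrite -!ball_normE /ball_ /= => xnz xmz.
  by rewrite -(subrKA z) (le_trans (ler_normD _ _))// lerD ?ltW// distrC.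
have [l [C xl]] : exists l C, geometric_cvg N x C l.
  apply: (@bnorm_complete _ N x 2%:R) => n.
  apply: le_trans (near_x n.+1 n) _.
  by rewrite mulr_natl mulr2n lerD2r invr_pow2_le.
have C0 : 0 <= C.
  have := le_trans (normr_ge0 ((l : E) - x 0%N)) (xl 0%N).
  by rewrite expr0 divr1.
apply/cvg_ex; exists (l : E); apply/cvgrPdist_lt => e e0.
have [||n ne] := @geometric_small K archi (C + 1) e => //.
  by rewrite addr_ge0.
apply: filterS (xF n) => z; rewrite -ball_normE /ball_ /= => xz.
rewrite -(subrKA (x n)) (le_lt_trans (ler_normD _ _))//.
apply: lt_trans ne; rewrite mulrDl mul1r ler_ltD//; exact: xl.
Qed.

HB.instance Definition _ := Uniform_isComplete.Build E banach_cauchy_cvg.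

Lemma banach_normE (x : E) : `|x| = N x.
Proof. by []. Qed.

End BanachBuilder.

Section BanachTheory.
Variable K : numFieldType.
Hypothesis archi : has_large_naturals K.

Lemma complete_geometrically (E : completeNormedModType K) :
  geometrically_complete (fun x : E => `|x|).
Proof.
move=> x C xC; have C0 : 0 <= C.
  by have := le_trans (normr_ge0 _) (xC 0%N); rewrite expr0 divr1.
have tail n m : (n <= m)%N -> `|x m - x n| <= 2%:R * C / 2%:R ^+ n.
  move=> nm; rewrite -(subnKC nm).
  apply: le_trans (geometric_tail _ _ (@ler_normD _ E) (normr0 E) xC) _.
  by rewrite lerBlDr lerDl divr_ge0 ?mulr_ge0 ?ler0n// ltW// pow2_gt0.
have C20 : 0 <= 2%:R * C by rewrite mulr_ge0.
have cx : cvg (x @ \oo).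
  apply: cauchy_cvg; apply/cauchyP => e e0.
  have [n ne] := geometric_small archi C20 e0; exists (x n); exists n => //.
  move=> m /= nm; rewrite -ball_normE /ball_ /= distrC.
  exact: le_lt_trans (tail _ _ nm) ne.
exists (lim (x @ \oo)), (2%:R * C) => n.
apply: (@le_geometric _ archi _ _ 1) => //.
  by rewrite divr_ge0// ltW// pow2_gt0.
move=> k; have e0 : 0 < (2%:R ^+ k)^-1 :> K by rewrite invr_gt0 pow2_gt0.
have /cvgrPdist_lt/(_ _ e0)[m _ xm] := cx.
have := xm (maxn m n) (leq_maxl _ _) => /= xmn.
rewrite -(subrKA (x (maxn m n))) (le_trans (ler_normD _ _))// addrC lerD//.
  exact/tail/leq_maxr.
by rewrite mul1r ltW.
Qed.

Lemma bounded_linear_continuous (E F : normedModType K) (f : E -> F) (M : K) :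
  linear f -> 0 <= M -> (forall x, `|f x| <= M * `|x|) -> continuous f.
Proof.
move=> lf M0 fM; apply: (@linear0_continuous _ E F) => // U.
move=> /nbhs_normP[e /= e0 eU]; apply/nbhs_normP.
have M1 : 0 < M + 1 by rewrite ltr_wpDl.
exists (e / (M + 1)) => /=; first by rewrite divr_gt0.
move=> x /=; rewrite sub0r normrN ltr_pdivlMr// => xe; apply: eU.
rewrite /= sub0r normrN (le_lt_trans (fM x))// (le_lt_trans _ xe)//.
by rewrite mulrC ler_wpM2l// lerDl.
Qed.

Lemma lcm_bounded (E F : normedModType K) (f : linear_continuous_map E F) :
  exists2 M, 0 < M & forall x, `|f x| <= M * `|x|.
Proof.
have /nbhs_normP[e /= e0 fe] : nbhs (0 : E) (f @^-1` [set y | `|y| < 1]).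
  apply: (lcm_continuous f 0); rewrite lcm0; apply/nbhs_normP; exists 1 => //=.
  by move=> y; rewrite /= sub0r normrN.
exists (2%:R / e); first by rewrite divr_gt0.
move=> x; have [->|x0] := eqVneq x 0; first by rewrite lcm0 !normr0 mulr0.
have nx : 0 < `|x| by rewrite normr_gt0.
have c0 : 0 < e / (2%:R * `|x|) by rewrite divr_gt0 ?mulr_gt0.
have := fe ((e / (2%:R * `|x|)) *: x); rewrite /= sub0r normrN normrZ.
rewrite (gtr0_norm c0) lcmZ normrZ (gtr0_norm c0).
have -> : e / (2%:R * `|x|) * `|x| = e / 2%:R.
  by field; rewrite normr_eq0.
rewrite ltr_pdivrMr// ltr_pMr// ltr1n => /(_ isT) fx.
have -> : 2%:R / e * `|x| = (e / (2%:R * `|x|))^-1.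
  by field; rewrite normr_eq0 x0 lt0r_neq0.
by rewrite -[leRHS]mul1r ler_pdivlMr// mulrC ltW.
Qed.

End BanachTheory.

(** * The category of Banach spaces *)

Section BanachCategory.
Variable K : numFieldType.
Hypothesis (archi : has_large_naturals K) (infima : has_infima K).

Let FB (E : completeNormedModType K) : tvsType K := E.

Definition ban_of (V : lmodType K) (N : banach_norm V) : BAN K :=
  (banach_space archi N : completeNormedModType K).

(** Sequential closedness in norm, tested only on sequences that converge at a geometric rate. *)
Definition geometrically_closed (E : BAN K) (S : set (FB E)) : Prop :=
  forall (x : nat -> (E : completeNormedModType K)) C l,
    (forall n, S (x n)) ->
    geometric_cvg (fun y : (E : completeNormedModType K) => `|y|) x C l -> S l.

Lemma ban_closed_ker (E F : BAN K) (f : linear_continuous_map (FB E) (FB F)) :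
  geometrically_closed [set x | f x = 0].
Proof.
move=> x C l fx xl; have [M M0 fM] := lcm_bounded
  (f : linear_continuous_map (E : completeNormedModType K)
    (F : completeNormedModType K)).
apply/eqP; rewrite -(@normr_eq0 _ (F : completeNormedModType K)).
apply/eqP/(@eq0_geometric _ archi _ (M * C)) => // n.
have -> : f l = f (l - x n) by rewrite lcmB fx subr0.
by rewrite (le_trans (fM _))// -mulrA ler_wpM2l ?(ltW M0).
Qed.

Lemma ban_has_sub (E : BAN K) (S : set (FB E)) : linear_subspace S ->
  geometrically_closed S ->
  exists (X : BAN K) (m : linear_continuous_map (FB X) (FB E)),
    strict_sub S m /\
    forall T : set (FB X), geometrically_closed T ->
      geometrically_closed (m @` T).
Proof.
move=> lS cS; pose E' : completeNormedModType K := E.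
pose val (w : submodule lS) : E' := submodule_val w.
pose N (w : submodule lS) : K := `|val w|.
have ND x y : N (x + y) <= N x + N y by exact: ler_normD.
have NZ a x : N (a *: x) = `|a| * N x by exact: normrZ.
have N0 x : N x = 0 -> x = 0.
  by move=> /eqP; rewrite normr_eq0 => /eqP x0; exact: submodule_val_inj.
have Nc : geometrically_complete N.
  move=> x C xC; have [l [C' xl]] := complete_geometrically archi xC.
  have [w wl] : exists w, val w = l.
    apply: submodule_val_surj; apply: cS xl => n; exact: submodule_valP.
  by rewrite -wl in xl; exists w, C'.
pose X := ban_of (BanachNorm ND NZ N0 Nc).
pose X' : completeNormedModType K := X.
have lm : linear (val : X' -> E') by [].
have cm : continuous (val : X' -> E').
  by apply: (bounded_linear_continuous lm ler01) => x; rewrite mul1r.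
exists X, (LinearContinuousMap lm cm); split.
  split.
  - exact: submodule_val_inj.
  - exact: submodule_valP.
  - exact: submodule_val_surj.
  move=> Y u Su; pose Y' : completeNormedModType K := Y.
  have [M M0 uM] := lcm_bounded (u : linear_continuous_map Y' E').
  pose v (x : Y') : X' := exist _ (u x) (Su x) : submodule lS.
  have lv : linear v.
    by move=> a x y; apply: submodule_val_inj; exact: lcm_linear.
  have cv : continuous v.
    exact: (bounded_linear_continuous lv (ltW M0) uM).
  by exists (LinearContinuousMap lv cv).
(* The embedding is isometric, so preimages in [T] converge at the same rate; the limit has a
   preimage because [S] is closed. *)
move=> T cT x C l Tx xl; have Sx n : S (x n).
  by have [w _ <-] := Tx n; exact: submodule_valP.
have [w wl] : exists w, val w = l by apply: submodule_val_surj; exact: cS xl.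
pose t n := sval (cid2 (Tx n)).
have tT n : T (t n) by rewrite /t; case: cid2.
have tx n : val (t n) = x n by rewrite /t; case: cid2.
exists w => //; apply: (cT t C) => // n.
by have := xl n; rewrite /= -wl -tx.
Qed.

(** The quotient norm: the infimum of the norms of all representatives of [y]. *)
Let inf_norm (V : completeNormedModType K) (Y : lmodType K) (q : V -> Y)
    (sq : forall y, exists x, q x = y) (y : Y) :
  {m : K | [/\ 0 <= m, forall x, q x = y -> m <= `|x| &
    forall e, 0 < e -> exists2 x, q x = y & `|x| < m + e]}.
Proof.
apply: cid; have [||m [m0 mA mB]] := infima (A := [set `|x| | x in q @^-1` [set y]]).
- by have [x xy] := sq y; exists `|x|, x.
- by move=> _ [x _ <-].
exists m; split=> // [x qx|e /mB[_ [x qx <-] xe]]; first by apply: mA; exists x.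
by exists x.
Qed.

Lemma ban_has_quo (E : BAN K) (S : set (FB E)) : linear_subspace S ->
  geometrically_closed S ->
  exists (X : BAN K) (q : linear_continuous_map (FB E) (FB X)),
    strict_quo S q.
Proof.
move=> lS cS; pose E' : completeNormedModType K := E.
pose Y : lmodType K := quotient_module lS.
pose q (x : E') : Y := quotient_pi lS x.
have lq : linear q by exact: quotient_pi_linear.
have qD := linear_funD lq; have qZ := linear_funZ lq.
have sq : forall y, exists x, q x = y by exact: quotient_pi_surj.
pose N (y : Y) : K := sval (inf_norm sq y).
have Nge0 y : 0 <= N y by case: (svalP (inf_norm sq y)).
have Nle x : N (q x) <= `|x|.
  by case: (svalP (inf_norm sq (q x))) => _ + _; exact.
have Ninf y e : 0 < e -> exists2 x, q x = y & `|x| < N y + e.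
  by case: (svalP (inf_norm sq y)) => _ _; exact.
have inv2 n : 0 < (2%:R ^+ n)^-1 :> K by rewrite invr_gt0 pow2_gt0.
have ND x y : N (x + y) <= N x + N y.
  apply: (@le_geometric _ archi _ _ 2%:R); rewrite ?addr_ge0// => n.
  have [u ux un] := Ninf x _ (inv2 n); have [v vy vn] := Ninf y _ (inv2 n).
  rewrite -ux -vy -qD (le_trans (Nle _))// (le_trans (ler_normD _ _))//.
  rewrite ux vy (le_trans (ltW (ltrD un vn)))// addrACA.
  by rewrite mulr_natl mulr2n.
have NZle a x : N (a *: x) <= `|a| * N x.
  apply: (@le_geometric _ archi _ _ `|a|); rewrite ?mulr_ge0// => n.
  have [u ux un] := Ninf x _ (inv2 n).
  rewrite -{1}ux -qZ (le_trans (Nle _))// normrZ -mulrDr ler_wpM2l//.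
  exact: ltW.
have NZ a x : N (a *: x) = `|a| * N x.
  apply/eqP; rewrite eq_le NZle /=; have [->|a0] := eqVneq a 0.
    by rewrite normr0 mul0r.
  rewrite -ler_pdivlMl ?normr_gt0// -normfV.
  by rewrite -[X in N X <= _](scalerK a0) scalerK// -{1}[x](scalerK a0) NZle.
(* Closedness of [S] gives definiteness: representatives [z n] tending to 0 make [u - z n] a
   sequence in [S] with limit [u]. *)
have N0 x : N x = 0 -> x = 0.
  move=> Nx0; have [u ux] := sq x.
  have ex n : exists z, q z = x /\ `|z| <= (2%:R ^+ n)^-1.
    have [z zx zn] := Ninf x _ (inv2 n); exists z; split=> //.
    by rewrite -[leRHS]add0r -Nx0 ltW.
  pose z n := sval (cid (ex n)).
  have zx n : q (z n) = x by rewrite /z; case: cid => ? [].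
  have zn n : `|z n| <= (2%:R ^+ n)^-1 by rewrite /z; case: cid => ? [].
  rewrite -ux; apply/quotient_pi_eq0; apply: (cS (fun n => u - z n) 1).
    move=> n; apply/(quotient_pi_eq lS); exact: (etrans ux (esym (zx n))).
  by move=> n; rewrite opprB addrC subrK mul1r.
(* The differences [y n.+1 - y n] are lifted with norms at most [(C + 1) / 2^n]; their partial sums
   lift [y] to a geometric Cauchy sequence of [E]. *)
have Nc : geometrically_complete N.
  move=> y C yC; have ex n : exists d, q d = y n.+1 - y n /\
      `|d| <= (C + 1) / 2%:R ^+ n.
    have [d dy dn] := Ninf (y n.+1 - y n) _ (inv2 n); exists d; split=> //.
    by rewrite mulrDl mul1r (le_trans (ltW dn))// lerD2r.
  have [x0 qx0] := sq (y 0%N).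
  pose d n := sval (cid (ex n)); pose x n := x0 + \sum_(i < n) d i.
  have qd n : q (d n) = y n.+1 - y n by rewrite /d; case: cid => ? [].
  have dn n : `|d n| <= (C + 1) / 2%:R ^+ n by rewrite /d; case: cid => ? [].
  have xS n : x n.+1 = x n + d n by rewrite /x big_ord_recr addrA.
  have qx n : q (x n) = y n.
    elim: n => [|n IHn]; first by rewrite /x big_ord0 addr0.
    by rewrite xS qD IHn qd addrC subrK.
  have [n|l [C' xl]] := @complete_geometrically _ archi E' x (C + 1).
    by rewrite xS addrC addKr.
  exists (q l), C' => n; apply: le_trans (xl n).
  by rewrite -qx -scaleN1r -qZ -qD scaleN1r.
pose X := ban_of (BanachNorm ND NZ N0 Nc).
pose X' : completeNormedModType K := X.
have cq : continuous (q : E' -> X').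
  by apply: (bounded_linear_continuous (F := X') lq ler01) => x; rewrite mul1r.
exists X, (@LinearContinuousMap K E' X' q lq cq); split=> //.
  exact: quotient_pi_eq0.
move=> Z u uS; pose Z' : completeNormedModType K := Z.
have [M M0 uM] := lcm_bounded (u : linear_continuous_map E' Z').
pose v (y : X') : Z' := u (sval (cid (sq y))).
have vq x : v (q x) = u x.
  rewrite /v; case: cid => /= z /(quotient_pi_eq lS) zx; apply/eqP.
  rewrite -subr_eq0 -(lcmB (u : linear_continuous_map E' Z')).
  exact/eqP/uS.
have lv : linear v.
  move=> c y z; have [x <-] := sq y; have [x' <-] := sq z.
  have -> : c *: (q x : X') + q x' = q (c *: x + x') by exact/esym/lq.
  by rewrite !vq; exact: lcm_linear.
have cv : continuous v.
  apply: (bounded_linear_continuous lv (ltW M0)) => y.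
  apply: (@le_geometric _ archi _ _ M) => //; first by rewrite mulr_ge0// ltW.
  move=> n; have [x xy xn] := Ninf y _ (inv2 n).
  rewrite -{1}xy vq (le_trans (uM _))// -mulrDr ler_wpM2l// ltW//.
by exists (LinearContinuousMap lv cv).
Qed.

Lemma ban_has_biproduct (E F : BAN K) : exists (X : BAN K)
    (m1 : linear_continuous_map (FB E) (FB X))
    (m2 : linear_continuous_map (FB F) (FB X))
    (p1 : linear_continuous_map (FB X) (FB E))
    (p2 : linear_continuous_map (FB X) (FB F)),
  [/\ forall x, p1 (m1 x) = x, forall y, p2 (m2 y) = y &
      forall z, m1 (p1 z) + m2 (p2 z) = z].
Proof.
pose E' : completeNormedModType K := E.
pose F' : completeNormedModType K := F.
pose V : lmodType K := (E' * F')%type.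
pose N (x : V) : K := `|x.1| + `|x.2|.
have ND x y : N (x + y) <= N x + N y.
  by rewrite /N addrACA; apply: lerD; exact: ler_normD.
have NZ a x : N (a *: x) = `|a| * N x by rewrite /N !normrZ mulrDr.
have N0 x : N x = 0 -> x = 0.
  move=> /eqP; rewrite paddr_eq0// !normr_eq0.
  by case: x => x y /andP[/eqP/= -> /eqP/= ->].
have Nc : geometrically_complete N.
  move=> x C xC.
  have [n|l [Cl xl]] := @complete_geometrically _ archi E' (fst \o x) C.
    by rewrite (le_trans _ (xC n))// lerDl.
  have [n|r [Cr xr]] := @complete_geometrically _ archi F' (snd \o x) C.
    by rewrite (le_trans _ (xC n))// lerDr.
  by exists (l, r), (Cl + Cr) => n; rewrite mulrDl; exact: lerD (xl n) (xr n).
pose X := ban_of (BanachNorm ND NZ N0 Nc).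
pose X' : completeNormedModType K := X.
pose m1 (x : E') : X' := (x, 0) : V.
pose m2 (y : F') : X' := (0, y) : V.
have lp1 : linear (fst : X' -> E') by [].
have lp2 : linear (snd : X' -> F') by [].
have lm1 : linear m1 by move=> a x y; congr pair; rewrite /= scaler0 addr0.
have lm2 : linear m2 by move=> a x y; congr pair; rewrite /= scaler0 addr0.
have cp1 : continuous (fst : X' -> E').
  apply: (bounded_linear_continuous lp1 ler01) => x.
  by rewrite mul1r [leRHS]banach_normE /= /N lerDl.
have cp2 : continuous (snd : X' -> F').
  apply: (bounded_linear_continuous lp2 ler01) => x.
  by rewrite mul1r [leRHS]banach_normE /= /N lerDr.
have cm1 : continuous m1.
  apply: (bounded_linear_continuous lm1 ler01) => x.
  by rewrite mul1r banach_normE /= /N /= normr0 addr0.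
have cm2 : continuous m2.
  apply: (bounded_linear_continuous lm2 ler01) => x.
  by rewrite mul1r banach_normE /= /N /= normr0 add0r.
exists X, (LinearContinuousMap lm1 cm1), (LinearContinuousMap lm2 cm2),
  (LinearContinuousMap lp1 cp1), (LinearContinuousMap lp2 cp2).
split=> //= -[x y]; congr pair; [exact: addr0|exact: add0r].
Qed.

Lemma ban_has_zero : exists Z : BAN K, zero_object Z.
Proof.
pose V : lmodType K := 'rV[K]_0; pose N (_ : V) : K := 0.
have ND x y : N (x + y) <= N x + N y by rewrite /N addr0.
have NZ a x : N (a *: x) = `|a| * N x by rewrite /N mulr0.
have N0 (x : V) : N x = 0 -> x = 0 by move=> _; exact: (@thinmx0 K 1 x).
have Nc : geometrically_complete N.
  by move=> x C xC; exists 0, C => n; exact: xC.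
exists (ban_of (BanachNorm ND NZ N0 Nc)).
by apply/(@full_zero_object K _ FB) => x; exact: (@thinmx0 K 1 x).
Qed.

Lemma ban_semi_abelian : semi_abelian (BAN K).
Proof.
apply: (@full_semi_abelian K _ FB ban_has_zero (@geometrically_closed)).
- move=> E P cP x C l Px xl S PS; apply: (cP S PS x C l) => // n.
  exact: Px.
- exact: ban_closed_ker.
- exact: ban_has_sub.
- exact: ban_has_quo.
- exact: ban_has_biproduct.
Qed.

End BanachCategory.

(** * Epimorphisms of Banach spaces under pullback *)

Section NullSequences.
Variable K : numFieldType.
Hypothesis (archi : has_large_naturals K) (infima : has_infima K).
Hypothesis scalar_complete : geometrically_complete (fun x : K => `|x|).

Let seqs : lmodType K := (nat -> K^o : lmodType K).

(** The space [c_0], with powers of 1/2 as tolerances to match the geometric rates. *)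
Let null : set seqs := [set x | forall k, exists n0, forall n, (n0 <= n)%N ->
  `|x n| <= (2%:R ^+ k)^-1].

Let half_sum k : (2%:R ^+ k.+1)^-1 + (2%:R ^+ k.+1)^-1 = (2%:R ^+ k)^-1 :> K.
Proof. by rewrite exprS; field; rewrite lt0r_neq0 ?pow2_gt0. Qed.

Let null_subspace : linear_subspace null.
Proof.
split=> [k|a x y nx ny k].
  by exists 0%N => n _; rewrite normr0 invr_ge0 ltW// pow2_gt0.
have [|m am] := geometric_small archi (normr_ge0 a) (e := (2%:R ^+ k.+1)^-1).
  by rewrite invr_gt0 pow2_gt0.
have [n1 xn1] := nx m; have [n2 yn2] := ny k.+1.
exists (maxn n1 n2) => n; rewrite geq_max => /andP[/xn1 xn /yn2 yn].
rewrite -half_sum (le_trans (ler_normD _ _))// lerD// normrM.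
by rewrite (le_trans _ (ltW am))// ler_wpM2l.
Qed.

Let V : lmodType K := submodule null_subspace.
Let val (x : V) : nat -> K := submodule_val x.

Let val_bounded (x : V) : exists2 c, 0 <= c & forall n, `|val x n| <= c.
Proof.
have [n0 xn0] := submodule_valP x 0%N.
have s0 : 0 <= \sum_(i < n0) `|val x i| by exact: sumr_ge0.
exists (\sum_(i < n0) `|val x i| + 1); first by rewrite addr_ge0.
move=> n; have [nn0|/xn0 xn] := ltnP n n0.
  rewrite (bigD1 (Ordinal nn0))//= -addrA lerDl addr_ge0// sumr_ge0//.
by rewrite (le_trans xn)// expr0 invr1 lerDr.
Qed.

(** Only infima are assumed, so the supremum norm is obtained as the infimum of the upper bounds. *)
Let sup_norm_ex (x : V) : {m : K | [/\ 0 <= m, forall n, `|val x n| <= m &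
  forall c, 0 <= c -> (forall n, `|val x n| <= c) -> m <= c]}.
Proof.
apply: cid; have [||m [m0 mA mB]] := infima
    (A := [set c | 0 <= c /\ forall n, `|val x n| <= c]).
- by have [c c0 xc] := val_bounded x; exists c.
- by move=> c [].
exists m; split=> // [n|c c0 xc]; last by apply: mA.
apply: (@le_geometric _ archi _ _ 1) => // k.
have [|c [_ xc] ck] := mB (1 / 2%:R ^+ k); first by rewrite divr_gt0 ?pow2_gt0.
by rewrite (le_trans (xc n))// ltW.
Qed.

Let N (x : V) : K := sval (sup_norm_ex x).
Let Nge0 x : 0 <= N x.
Proof. by case: (svalP (sup_norm_ex x)). Qed.
Let N_ub x n : `|val x n| <= N x.
Proof. by case: (svalP (sup_norm_ex x)) => _ + _; exact. Qed.
Let N_le x c : 0 <= c -> (forall n, `|val x n| <= c) -> N x <= c.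
Proof. by case: (svalP (sup_norm_ex x)) => _ _; exact. Qed.

Let ND x y : N (x + y) <= N x + N y.
Proof.
apply: N_le => [|n]; first by rewrite addr_ge0.
by rewrite (le_trans (ler_normD _ _))// lerD.
Qed.

Let NZle a x : N (a *: x) <= `|a| * N x.
Proof.
apply: N_le => [|n]; first by rewrite mulr_ge0.
by rewrite [X in `|X|](_ : _ = a * val x n)// normrM ler_wpM2l.
Qed.

Let NZ a x : N (a *: x) = `|a| * N x.
Proof.
apply/eqP; rewrite eq_le NZle /=; have [->|a0] := eqVneq a 0.
  by rewrite normr0 mul0r.
by rewrite -ler_pdivlMl ?normr_gt0// -normfV -{1}[x](scalerK a0) NZle.
Qed.

Let N0_eq0 x : N x = 0 -> x = 0.
Proof.
move=> Nx0; apply: submodule_val_inj; apply/funext => n.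
by apply/eqP; rewrite -normr_le0 -Nx0; exact: N_ub.
Qed.

Let Nc : geometrically_complete N.
Proof.
move=> x C xC; have C0 : 0 <= C.
  by have := le_trans (Nge0 _) (xC 0%N); rewrite expr0 divr1.
(* The rate [2 C] is the same for all coordinates [n], so coordinatewise limits give convergence in
   the supremum norm. *)
have ex n : exists l, geometric_cvg (fun x : K => `|x|)
    (fun m => val (x m) n) (2%:R * C) l.
  have vC : geometric_cauchy (fun x : K => `|x|) (fun m => val (x m) n) C.
    by move=> m; apply: le_trans (xC m); exact: (N_ub (x m.+1 - x m) n).
  have [l [C' lC']] := scalar_complete vC; exists l.
  exact: (geometric_limit_rate archi (@ler_normD _ K) (normr0 K) _ vC lC').
pose l n := sval (cid (ex n)).
have xl n m : `|l n - val (x m) n| <= 2%:R * C / 2%:R ^+ m.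
  exact: (svalP (cid (ex n)) m).
have C20 : 0 <= 2%:R * C by rewrite mulr_ge0.
have [w wl] : exists w : V, submodule_val w = l.
  apply: submodule_val_surj => k.
  have [|m mk] := geometric_small archi C20 (e := (2%:R ^+ k.+1)^-1).
    by rewrite invr_gt0 pow2_gt0.
  have [n0 xn0] := submodule_valP (x m) k.+1.
  exists n0 => n /xn0 xn; rewrite -(subrK (val (x m) n) (l n)) -half_sum.
  rewrite (le_trans (ler_normD _ _))// lerD//.
  by rewrite (le_trans (xl n m))// ltW.
exists w, (2%:R * C) => m; apply: N_le => [|n].
  by rewrite divr_ge0// ltW// pow2_gt0.
by rewrite [X in `|X|](_ : _ = l n - val (x m) n)// -wl.
Qed.

Let X : BAN K := ban_of archi (BanachNorm ND NZ N0_eq0 Nc).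
Let X' : completeNormedModType K := X.

Let scalar_norm : banach_norm (K^o : lmodType K).
Proof.
by apply: (@BanachNorm K (K^o : lmodType K) (fun x : K => `|x|));
  [exact: ler_normD|exact: normrM|exact: normr0_eq0|exact: scalar_complete].
Defined.

Let F : BAN K := ban_of archi scalar_norm.
Let F' : completeNormedModType K := F.

Let inv_le1 n : (n.+1%:R)^-1 <= 1 :> K.
Proof. by rewrite invf_le1 ?ltr0n// ler1n. Qed.

Let shrink_null (x : V) : null (fun n => val x n / n.+1%:R).
Proof.
move=> k; have [n0 xn0] := submodule_valP x k; exists n0 => n /xn0.
apply: le_trans; rewrite normrM ler_piMr// ger0_norm ?invr_ge0//.
Qed.

Let shrink (x : X') : X' := exist _ _ (shrink_null x) : V.

Let shrink_linear : linear shrink.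
Proof.
move=> a x y; apply: submodule_val_inj; apply/funext => n.
by rewrite /= [LHS]mulrDl -mulrA.
Qed.

Let shrink_continuous : continuous shrink.
Proof.
apply: (bounded_linear_continuous shrink_linear ler01) => x; rewrite mul1r.
apply: N_le => // n; apply: le_trans (N_ub x n).
by rewrite normrM ler_piMr// ger0_norm ?invr_ge0.
Qed.

Let d : linear_continuous_map X' X' :=
  LinearContinuousMap shrink_linear shrink_continuous.

Let harmonic_null : null (fun n => (n.+1%:R)^-1).
Proof.
move=> k; have [n0 n0k] := archi (pow2_gt0 K k); exists n0 => n n0n.
rewrite ger0_norm ?invr_ge0// lef_pV2 ?posrE ?pow2_gt0 ?ltr0n//.
by rewrite (le_trans (ltW n0k))// ler_nat (leq_trans n0n).
Qed.

Let harmonic : X' := exist _ _ harmonic_null : V.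

Let line (t : F') : X' := (t : K) *: harmonic.

Let line_linear : linear line.
Proof. by move=> a s t; rewrite /line scalerDl -scalerA. Qed.

Let line_continuous : continuous line.
Proof.
apply: (bounded_linear_continuous line_linear (normr_ge0 harmonic)) => t.
by rewrite /line normrZ mulrC.
Qed.

Let c : linear_continuous_map F' X' :=
  LinearContinuousMap line_linear line_continuous.

(* The range of d contains all finitely supported sequences. *)
Let d_epi : epi (C := BAN K) (A := X) (B := X) d.
Proof.
move=> Y g h gh; apply: lcm_ext => y; pose Y' : completeNormedModType K := Y.
pose f : linear_continuous_map X' Y' := lcm_add
  (g : linear_continuous_map X' Y') (lcm_opp (h : linear_continuous_map X' Y')).
have fd x : f (d x) = 0.
  have /= := congr1 (fun u : linear_continuous_map X' Y' => u x) gh.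
  by move=> ->; rewrite subrr.
apply: subr0_eq; have yn k := submodule_valP (y : V) k.
pose n0 k := sval (cid (yn k)).
have yn0 k n : (n0 k <= n)%N -> `|val y n| <= (2%:R ^+ k)^-1.
  exact: (svalP (cid (yn k)) n).
(* [z k] is the preimage under [d] of [y] cut off at [n0 k], beyond which the entries of [y] are at
   most [2^-k]. So [d (z k)] tends to [y], and the closed kernel of [g - h] contains [y]. *)
have trunc k : exists z : V, forall n,
    val z n = if (n < n0 k)%N then n.+1%:R * val y n else 0.
  suff /(submodule_val_surj null_subspace)[z zE] : null (fun n =>
      if (n < n0 k)%N then n.+1%:R * val y n else 0).
    by exists z => n; rewrite /val zE.
  by move=> j; exists (n0 k) => n nk; rewrite ltnNge nk normr0 invr_ge0 ltW ?pow2_gt0.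
pose z k : X' := sval (cid (trunc k)).
have zE k n := svalP (cid (trunc k)) n.
apply: (@ban_closed_ker K archi X Y f (fun k => d (z k)) 1) => [k|k].
  exact: fd.
apply: N_le => [|n]; first by rewrite divr_ge0// ltW// pow2_gt0.
rewrite [X in `|X|](_ : _ = val y n - val (z k) n / n.+1%:R)// mul1r.
rewrite zE; case: ltnP => [nk|/yn0 ynk]; last by rewrite mul0r subr0.
by rewrite mulrAC divff ?pnatr_eq0// mul1r subrr normr0 invr_ge0 ltW// pow2_gt0.
Qed.

Let square (Z : BAN K) (Z0 : forall z : (Z : completeNormedModType K), z = 0) :
  pullback_square (C := BAN K) (A := Z) (B := F) (E := X) (D := X)
    (lcm_zero (Z : completeNormedModType K) F')
    (lcm_zero (Z : completeNormedModType K) X') c d.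
Proof.
split.
  by apply: lcm_ext => z; exact: (etrans (@lcm0 _ F' X' c) (esym (@lcm0 _ X' X' d))).
move=> Y u0 v0 uv; pose Y' : completeNormedModType K := Y.
pose u : linear_continuous_map Y' F' := u0.
pose v : linear_continuous_map Y' X' := v0.
(* Comparing entries and cancelling [n + 1] shows that [v y] is the constant sequence [u y], which
   is null only if [u y = 0]. *)
have uvE (y : Y') n : (u y : K) / n.+1%:R = val (v y) n / n.+1%:R.
  have := congr1 (fun h : linear_continuous_map Y' X' => val (h y) n) uv.
  by [].
have vE (y : Y') n : val (v y) n = u y.
  have n0 : (n.+1%:R)^-1 != 0 :> K by rewrite invr_eq0 pnatr_eq0.
  exact/esym/(mulIf n0)/uvE.
have u0E (y : Y') : (u y : K) = 0.
  apply/eqP; rewrite -normr_eq0; apply/eqP/(@eq0_geometric _ archi _ 1) => // k.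
  have [n0 vn0] := submodule_valP (v y : V) k.
  by rewrite mul1r; have := vn0 n0 (leqnn _); rewrite -/(val (v y) n0) vE.
have v0E (y : Y') : v y = 0.
  apply: submodule_val_inj; apply/funext => n.
  by rewrite -[LHS]/(val (v y) n) vE u0E.
exists (lcm_zero Y' (Z : completeNormedModType K)); split.
  by split; apply: lcm_ext => y; [exact/esym/u0E|exact/esym/v0E].
by move=> w _; apply: lcm_ext => y; rewrite [RHS]Z0.
Qed.

Lemma ban_epi_not_pullback_stable :
  ~ stable_under_pullback (C := BAN K) (@epi _).
Proof.
have [Z /(@full_zero_object K _ (fun E : completeNormedModType K => E)) Z0] :=
  ban_has_zero archi.
move=> st; have eF := st _ _ _ _ _ _ _ _ (square Z0) d_epi.
(* An epimorphism from the zero space to [F] would identify the identity and the zero map of the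
   scalars. *)
have e : lcm_id F' = lcm_zero F' F' by apply: eF; exact: lcm_ext.
have := congr1 (fun h : linear_continuous_map F' F' => (h (1 : K^o) : K)) e.
by move=> /eqP; rewrite oner_eq0.
Qed.

End NullSequences.

(** * Real and complex scalars *)

Section Scalars.
Variable R : realType.

Lemma real_large_naturals : has_large_naturals R.
Proof. by move=> x x0; exists (Num.bound x); exact: archi_boundP (ltW x0). Qed.

Lemma real_infima : has_infima R.
Proof.
move=> A A0 Age0; have lA : has_lbound A by exists 0 => x /Age0.
exists (inf A); split.
- exact: lb_le_inf.
- by move=> x Ax; exact: ge_inf.
- by move=> e e0; have [x Ax xe] := inf_adherent e0 (conj A0 lA); exists x.
Qed.

Lemma real_geometrically_complete :
  geometrically_complete (fun x : R => `|x|).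
Proof.
exact: (@complete_geometrically R real_large_naturals
  (R^o : completeNormedModType R)).
Qed.

Local Open Scope complex_scope.

(** Nonnegative complex numbers are real, which reduces the order-theoretic requirements on the
    complex field to those on [R]. *)
Lemma complex_ge0P (z : R[i]) : 0 <= z -> z = (complex.Re z)%:C /\ 0 <= complex.Re z.
Proof. by case: z => a b; rewrite lecE /= => /andP[/eqP -> ->]. Qed.

Lemma complex_large_naturals : has_large_naturals (R[i] : numFieldType).
Proof.
move=> z z0; have [zE _] := complex_ge0P (ltW z0).
have [n xn] : exists n, complex.Re z < n%:R.
  by apply: real_large_naturals; move: z0; rewrite zE ltcR.
by exists n; rewrite zE -(rmorph_nat (real_complex R)) ltcR.
Qed.

Lemma complex_infima : has_infima (R[i] : numFieldType).
Proof.
move=> A [z0 Az0] Age0; have [||m [m0 mA mB]] := @real_infima (@complex.Re R @` A).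
- by exists (complex.Re z0), z0.
- by move=> _ [z Az <-]; have [] := complex_ge0P (Age0 _ Az).
exists m%:C; split; first by rewrite lecR.
- move=> z Az; have [-> _] := complex_ge0P (Age0 _ Az).
  by rewrite lecR; apply: mA; exists z.
- move=> e e0; have [eE _] := complex_ge0P (ltW e0).
  have [|_ [z Az <-] ze] := mB (complex.Re e); first by move: e0; rewrite eE ltcR.
  exists z => //; have [-> _] := complex_ge0P (Age0 _ Az).
  by rewrite eE -rmorphD ltcR.
Qed.

Lemma normc_ge_Im (z : R[i]) : `|complex.Im z|%:C <= `|z|.
Proof.
rewrite normc_def lecR -sqrtr_sqr ler_wsqrtr// lerDr sqr_ge0//.
Qed.

Lemma complex_geometrically_complete :
  geometrically_complete (fun z : (R[i] : numFieldType) => `|z|).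
Proof.
move=> z C zC.
have [CE C0] : C = (complex.Re C)%:C /\ 0 <= complex.Re C.
  apply: complex_ge0P.
  by have := le_trans (normr_ge0 _) (zC 0%N); rewrite expr0 divr1.
have rate (x : R) n : (x / 2%:R ^+ n)%:C = x%:C / 2%:R ^+ n :> R[i].
  by rewrite rmorphM fmorphV rmorphXn rmorph_nat.
have [n|a [Ca za]] := @real_geometrically_complete
    (fun n => complex.Re (z n)) (complex.Re C).
  rewrite -lecR rate -CE; apply: le_trans (zC n); rewrite -raddfB.
  exact: normc_ge_Re.
have [n|b [Cb zb]] := @real_geometrically_complete
    (fun n => complex.Im (z n)) (complex.Re C).
  rewrite -lecR rate -CE; apply: le_trans (zC n); rewrite -raddfB.
  exact: normc_ge_Im.
exists (a +i* b), (Ca + Cb)%:C => n.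
rewrite [a +i* b]complexE [z n]complexE opprD addrACA -mulrBr -!rmorphB.
rewrite (le_trans (ler_normD _ _))// normrM.
rewrite (_ : `|'i%C| = 1 :> R[i]) ?mul1r; last by rewrite normc_def /= expr0n expr1n add0r sqrtr1.
rewrite -rate mulrDl [leRHS]rmorphD lerD// normc_def /= expr0n addr0 sqrtr_sqr lecR.
  exact: za.
exact: zb.
Qed.

End Scalars.

Lemma ban_bor_semi_abelian (K : numFieldType) :
  has_large_naturals K -> has_infima K ->
  geometrically_complete (fun x : K => `|x|) ->
  semi_abelian (prod_category (BAN K) (BOR K)) /\
  ~ integral_category (prod_category (BAN K) (BOR K)) /\
  ~ quasi_abelian (prod_category (BAN K) (BOR K)).
Proof.
move=> archi infima complete; split; last split.
- apply: semi_abelian_prod; first exact: ban_semi_abelian.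
  exact: bor_semi_abelian.
- have [Z _] := bor_has_zero K; move=> [_ st _].
  apply: (ban_epi_not_pullback_stable archi infima complete).
  exact: stable_under_pullback_epi_prod Z st.
- have [Z zZ] := ban_has_zero archi; move=> [_ st _].
  apply: (bor_cokernel_not_pullback_stable archi).
  exact: stable_under_pullback_cokernel_prod zZ st.
Qed.

Theorem theorem3p8 :
  (exists C : category,
     semi_abelian C /\ ~ integral_category C /\ ~ quasi_abelian C) /\
  (forall (R : realType) (k : numFieldType),
     k = (R : numFieldType) \/ k = (R[i]%C : numFieldType) ->
     semi_abelian (prod_category (BAN k) (BOR k)) /\
     ~ integral_category (prod_category (BAN k) (BOR k)) /\
     ~ quasi_abelian (prod_category (BAN k) (BOR k))).
Proof.
have main (R : realType) (k : numFieldType) :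
    k = (R : numFieldType) \/ k = (R[i]%C : numFieldType) ->
    semi_abelian (prod_category (BAN k) (BOR k)) /\
    ~ integral_category (prod_category (BAN k) (BOR k)) /\
    ~ quasi_abelian (prod_category (BAN k) (BOR k)).
  move=> [|] ->; apply: ban_bor_semi_abelian.
  - exact: real_large_naturals.
  - exact: real_infima.
  - exact: real_geometrically_complete.
  - exact: complex_large_naturals.
  - exact: complex_infima.
  - exact: complex_geometrically_complete.
split; last exact: main.
(* The existence claim fixes no field, so a concrete field of real numbers is supplied. *)
exists (prod_category (BAN (Rdefinitions.R : realType))
  (BOR (Rdefinitions.R : realType))).
by apply: (main Rdefinitions.R); left.
Qed.
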